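(* Let $m\ge n\ge 1$ be integers and let $E$ be an $n$-dimensional linear subspace of $\mathbb{R}^m$. Then $$|P_E B_2^m|_n\le 2^n\,|P_E(B_2^m\cap\mathbb{R}^m_+)|_n .$$ Moreover, equality holds if and only if there exists a partition $U_0,U_1,\dots,U_n$ of $[m]=\{1,\dots,m\}$ such that $U_j\neq\emptyset$ for every $1\le j\le n$, $U_0=\{i\in[m]:P_Ee_i=0\}$, and for every $1\le j\le n$ there exists a unit vector $w_j\in\sum_{i\in U_j}\mathbb{R}_{>0}\,e_i$ such that $E=\mathrm{span}(w_1,\dots,w_n)$.
   Context: $e_1,\dots,e_m$ is the canonical basis of $\mathbb{R}^m$; $B_2^m$ is the closed Euclidean unit ball of $\mathbb{R}^m$; $\mathbb{R}^m_+=\{x\in\mathbb{R}^m: x_i\ge 0\ \text{for all } i\}$. $P_E$ is the orthogonal projection onto $E$, and $|\cdot|_n$ is $n$-dimensional Lebesgue measure (on $E$). $\sum_{i\in U}\mathbb{R}_{>0}e_i$ is the set of vectors $\sum_{i\in U}\lambda_ie_i$ with all $\lambda_i>0$. The set $U_0$ in the partition is allowed to be empty. *)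

(* Defs.v *)
From HB Require Import structures.
From mathcomp Require Import all_boot all_order all_algebra.
From mathcomp Require Import all_classical all_reals all_analysis.

Set Implicit Arguments.
Unset Strict Implicit.
Unset Printing Implicit Defensive.

Import Order.TTheory GRing.Theory Num.Theory.

Local Open Scope classical_set_scope.
Local Open Scope ring_scope.

Section cons_measure.
Local Open Scope ereal_scope.
Context {d} {T : measurableType d} {R : realType} (n : nat).

Definition tcons (p : T * n.-tuple T) : n.+1.-tuple T := [tuple of p.1 :: p.2].

Lemma measurable_tcons : measurable_fun [set: T * n.-tuple T] tcons.
Proof. exact: (measurable_cons measurable_fst measurable_snd). Qed.

Variable m1 : {sigma_finite_measure set T -> \bar R}.
Variable m2 : {sigma_finite_measure set (n.-tuple T) -> \bar R}.

Definition cons_measure : set (n.+1.-tuple T) -> \bar R :=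
  pushforward (m1 \x m2) tcons.

Let mpre (A : set (n.+1.-tuple T)) : measurable A ->
  measurable (tcons @^-1` A).
Proof. by move=> mA; rewrite -[X in measurable X]setTI; exact: measurable_tcons. Qed.

Let cons_measure0 : cons_measure set0 = 0.
Proof. by rewrite /cons_measure /pushforward preimage_set0 measure0. Qed.

Let cons_measure_ge0 A : 0 <= cons_measure A.
Proof. by rewrite /cons_measure /pushforward measure_ge0. Qed.

Let cons_measure_sigma_additive : semi_sigma_additive cons_measure.
Proof.
move=> F mF tF mUF; rewrite /cons_measure /pushforward preimage_bigcup.
apply: measure_semi_sigma_additive.
- by move=> k; exact: mpre.
- apply/trivIsetP => /= i j _ _ ij; rewrite -preimage_setI.
  by move/trivIsetP : tF => /(_ _ _ _ _ ij) ->//; rewrite preimage_set0.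
- by rewrite -preimage_bigcup; exact: mpre.
Qed.

HB.instance Definition _ := isMeasure.Build _ _ _ cons_measure
  cons_measure0 cons_measure_ge0 cons_measure_sigma_additive.

Let tuncons (t : n.+1.-tuple T) : T * n.-tuple T :=
  (thead t, [tuple of behead t]).

Let measurable_tuncons : measurable_fun [set: n.+1.-tuple T] tuncons.
Proof.
apply/measurable_fun_pair; first exact: measurable_tnth.
exact: measurable_behead.
Qed.

Let tconsK : cancel tcons tuncons.
Proof. by case=> x t; congr pair; exact: val_inj. Qed.

Let cons_measure_sigma_finite : sigma_finite setT cons_measure.
Proof.
have /sigma_finiteP[F [FT ndF Foo]] := sigma_finiteT m1.
have /sigma_finiteP[G [GT ndG Goo]] := sigma_finiteT m2.
exists (fun k => tuncons @^-1` (F k `*` G k)).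
  apply/seteqP; split => // t _.
  have [i _ Fi] : (\bigcup_i F i) (tuncons t).1 by rewrite -FT.
  have [j _ Gj] : (\bigcup_i G i) (tuncons t).2 by rewrite -GT.
  exists (maxn i j) => //; split => /=.
    by apply: (subsetPset _ _ (ndF _ _ (leq_maxl i j))).
  by apply: (subsetPset _ _ (ndG _ _ (leq_maxr i j))).
move=> k; have [mF Fk] := Foo k; have [mG Gk] := Goo k; split.
  by rewrite -[X in measurable X]setTI; apply: measurable_tuncons => //;
    exact: measurableX.
rewrite /cons_measure /pushforward -comp_preimage.
rewrite (_ : tuncons \o tcons = idfun)/=; last first.
  by apply/funext => p /=; rewrite tconsK.
by rewrite product_measure1E// lte_mul_pinfty// ge0_fin_numE.
Qed.

HB.instance Definition _ := Measure_isSigmaFinite.Build _ _ _ cons_measure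
  cons_measure_sigma_finite.

End cons_measure.

(* The [n]-fold product measure on [R^n]; its values are meaningful on the
   product (i.e. Borel) sigma-algebra. *)
Fixpoint lebesgue_tuple {R : realType} (n : nat) :
    {sigma_finite_measure set (n.-tuple (measurableTypeR R)) -> \bar R} :=
  if n is k.+1 then cons_measure lebesgue_measure (lebesgue_tuple k)
  else \d_([tuple] : 0.-tuple (measurableTypeR R)).

Lemma lebesgue_tuple_setX (R : realType) (n : nat)
    (A : 'I_n -> set (measurableTypeR R)) : (forall i, measurable (A i)) ->
  (lebesgue_tuple n [set t | forall i, A i (tnth t i)] =
   \prod_(i < n) lebesgue_measure (A i))%E.
Proof.
elim: n A => [|n IH] A mA.
  by rewrite big_ord0 /= diracE mem_set//= => -[].
rewrite big_ord_recl -IH//.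
rewrite -product_measure1E//; last first.
  rewrite (_ : mkset _ = \bigcap_(i in [set: 'I_n])
      ((@tnth _ _)^~ i @^-1` A (lift ord0 i))).
    apply: fin_bigcap_measurable => // i _.
    by rewrite -[X in measurable X]setTI; exact: measurable_tnth.
  by apply/seteqP; split => t /= h i; [move=> _|]; apply: h.
rewrite /= /cons_measure /pushforward; congr (_ _).
apply/seteqP; split => -[x t] /=.
  move=> h; split; first exact: (h ord0).
  by move=> i; have := h (lift ord0 i); rewrite tnthS.
case=> hx ht i; case: (unliftP ord0 i) => [j ->|->//].
by rewrite tnthS; exact: ht.
Qed.

Section euclidean.
Context {R : realType} {m : nat}.
Implicit Types (u v w x : 'rV[R]_m) (E : {vspace 'rV[R]_m}).

Definition dotv u v : R := \sum_(i < m) u 0 i * v 0 i.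

Definition enorm u : R := Num.sqrt (dotv u u).

Definition dotvr v u : R^o := dotv u v.

Lemma dotvr_is_linear v : linear (dotvr v).
Proof.
move=> a x y; rewrite /dotvr /dotv /GRing.scale/= big_distrr/= -big_split/=.
by apply: eq_bigr => i _; rewrite !mxE mulrDl mulrA.
Qed.

HB.instance Definition _ v :=
  GRing.isLinear.Build R 'rV[R]_m R^o *:%R (dotvr v) (dotvr_is_linear v).

Definition orthv E : {vspace 'rV[R]_m} :=
  (\bigcap_(i < \dim E) lker (linfun (dotvr (tnth (vbasis E) i))))%VS.

Definition oproj E : 'End('rV[R]_m) := daddv_pi E (orthv E).

Definition is_onb E (b : (\dim E).-tuple 'rV[R]_m) : Prop :=
  basis_of E b /\
  forall i j : 'I_(\dim E), dotv (tnth b i) (tnth b j) = (i == j)%:R.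

Definition onb E : (\dim E).-tuple 'rV[R]_m :=
  xget (vbasis E) [set b | is_onb b].

(* Image of the Lebesgue measure of [R^(\dim E)] under the linear isometry
   onto [E] given by an orthonormal basis; the choice of the basis is
   immaterial by rotation invariance. *)
Definition lebesgue_on E (A : set 'rV[R]_m) : \bar R :=
  lebesgue_tuple (\dim E) [set t | A (\sum_i tnth t i *: tnth (onb E) i)].

Definition unit_ball : set 'rV[R]_m := [set x | enorm x <= 1].

Definition nonneg_orthant : set 'rV[R]_m := [set x | forall i, 0 <= x 0 i].

Definition pos_cone (U : {set 'I_m}) : set 'rV[R]_m :=
  [set x | exists2 l : 'I_m -> R, forall i, i \in U -> 0 < l i &
           x = \sum_(i in U) l i *: delta_mx 0 i].

Lemma dotvC u v : dotv u v = dotv v u.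
Proof. by apply: eq_bigr => i _; rewrite mulrC. Qed.

Lemma dotv_suml I (r : seq I) (P : pred I) (F : I -> 'rV[R]_m) v :
  dotv (\sum_(i <- r | P i) F i) v = \sum_(i <- r | P i) dotv (F i) v.
Proof. exact: (linear_sum (dotvr v)). Qed.

Lemma dotvZl a u v : dotv (a *: u) v = a * dotv u v.
Proof. exact: (linearZ_LR (dotvr v)). Qed.

Lemma dotvZr a u v : dotv v (a *: u) = a * dotv v u.
Proof. by rewrite dotvC dotvZl dotvC. Qed.

Lemma dotvBl u v w : dotv (u - v) w = dotv u w - dotv v w.
Proof. exact: (linearB (dotvr w)). Qed.

Lemma dotv_ge0 u : 0 <= dotv u u.
Proof. by apply: sumr_ge0 => i _; rewrite -expr2 sqr_ge0. Qed.

Lemma dotv_eq0 u : (dotv u u == 0) = (u == 0).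
Proof.
apply/eqP/eqP => [h|->]; last by rewrite /dotv big1// => i _; rewrite mxE mul0r.
apply/rowP => i; rewrite mxE.
have := psumr_eq0P (fun i _ => sqr_ge0 (u 0 i)) h.
by move=> /(_ i isT)/eqP; rewrite -/(_ ^+ 2) sqrf_eq0 => /eqP.
Qed.

Lemma mem_orthv E v :
  (v \in orthv E) <-> (forall u, u \in E -> dotv v u = 0).
Proof.
rewrite memvE; split=> [/subv_bigcapP h u uE|h]; last first.
  apply/subv_bigcapP => i _; rewrite -memvE memv_ker lfunE/=; apply/eqP/h.
  by apply: vbasis_mem; exact: mem_tnth.
rewrite (coord_vbasis uE) dotvC dotv_suml big1// => i _.
have := h i isT; rewrite -memvE memv_ker lfunE/= => /eqP.
by rewrite /dotvr (tnth_nth 0) dotvZl dotvC => ->; rewrite mulr0.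
Qed.

Lemma gram_schmidt (s : seq 'rV[R]_m) : exists o : seq 'rV[R]_m,
  span o = span s /\
  forall i j, (i < size o)%N -> (j < size o)%N -> dotv o`_i o`_j = (i == j)%:R.
Proof.
elim: s => [|x s [ o [so ono]]]; first by exists [::].
pose p := \sum_(i < size o) dotv x o`_i *: o`_i.
have po : p \in <<o>>%VS.
  by apply: memv_suml => i _; apply/memvZ/memv_span/mem_nth.
pose y := x - p.
have yo j : (j < size o)%N -> dotv y o`_j = 0.
  move=> jo; rewrite dotvBl dotv_suml (bigD1 (Ordinal jo))//= dotvZl ono// eqxx.
  rewrite mulr1 big1 ?addr0 ?subrr// => i ij.
  by rewrite dotvZl ono// (negbTE (_ : (i : nat) != j)) ?mulr0.
have sE : (<<x :: s>> = <[y]> + <<o>>)%VS.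
  rewrite span_cons -so; apply/eqP; rewrite eqEsubv.
  rewrite !subv_add !addvSr !andbT -!memvE; apply/andP; split.
    by rewrite -(subrK p x); apply: memv_add => //; exact: memv_line.
  by apply: memvB; [|rewrite (subvP (addvSr _ _))];
    rewrite // (subvP (addvSl _ _))// memv_line.
have [y0|y0] := eqVneq y 0.
  exists o; split => //; rewrite sE y0; apply/esym/addv_idPr.
  by rewrite -memvE mem0v.
have yy : 0 < dotv y y by rewrite lt_neqAle dotv_ge0 eq_sym dotv_eq0 y0.
pose c := (enorm y)^-1.
have c0 : c != 0 by rewrite invr_eq0 gt_eqF// sqrtr_gt0.
exists (c *: y :: o); split.
  rewrite sE span_cons; congr (_ + _)%VS; apply/eqP; rewrite eqEsubv -!memvE.
  apply/andP; split; first by rewrite memvZ// memv_line.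
  by rewrite -[y in X in X \in _](scalerK c0) memvZ// memv_line.
move=> [|i] [|j] //= ; rewrite ?ltnS => ilt jlt.
- rewrite dotvZl dotvZr mulrA -expr2 exprVn sqr_sqrtr ?dotv_ge0//.
  by rewrite mulVf// gt_eqF.
- by rewrite dotvZl yo// mulr0.
- by rewrite dotvZr dotvC yo// mulr0.
- exact: ono.
Qed.

Lemma onbP E : is_onb (onb E).
Proof.
have [ o [so ono]] := gram_schmidt (vbasis E).
rewrite (span_basis (vbasisP E)) in so.
have fo : free (in_tuple o).
  apply/freeP => k k0 i.
  have := congr1 (fun z => dotv z o`_i) k0; rewrite dotv_suml (bigD1 i)//=.
  rewrite dotvZl ono// eqxx mulr1 big1 ?addr0 => [->|j ji].
    exact: (linear0 (dotvr o`_i)).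
  by rewrite dotvZl ono// (negbTE (_ : (j : nat) != i)) ?mulr0.
have bo : basis_of E o by rewrite /basis_of so eqxx.
have sz : size o == \dim E by rewrite (size_basis (bo : basis_of E (in_tuple o))).
apply: (@xgetI _ _ _ (Tuple sz)); split => //= i j.
by rewrite !(tnth_nth 0) ono ?(eqP sz).
Qed.

Lemma oproj_mem E x : oproj E x \in E.
Proof. exact: memv_pi. Qed.

Lemma oproj_orth E x u : u \in E -> dotv (x - oproj E x) u = 0.
Proof.
have EO : (E :&: orthv E = 0)%VS.
  apply/eqP; rewrite -subv0; apply/subvP => v /memv_capP[vE /mem_orthv vO].
  by rewrite memv0 -dotv_eq0 vO.
have [/andP[/eqP sb fb] ob] := onbP E.
pose p := \sum_i dotv x (tnth (onb E) i) *: tnth (onb E) i.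
have bE i : tnth (onb E) i \in E by apply: (basis_mem (onbP E).1); exact: mem_tnth.
have xEO : x \in (E + orthv E)%VS.
  rewrite -(subrK p x) addrC; apply: memv_add.
    by apply: memv_suml => i _; rewrite memvZ.
  apply/mem_orthv => v; rewrite -{1}sb => /coord_span ->.
  rewrite dotvC dotv_suml big1// => i _.
  rewrite dotvZl -tnth_nth dotvC dotvBl dotv_suml (bigD1 i)//= dotvZl ob eqxx.
  rewrite mulr1 big1 ?addr0 ?subrr ?mulr0// => j /negbTE ji.
  by rewrite dotvZl ob ji mulr0.
move=> uE; rewrite -[x in x - _](daddv_pi_add EO xEO) addrC addKr.
by have /mem_orthv -> := memv_pi (orthv E) E x.
Qed.

End euclidean.

(* Main.v *)
Require Import Defs.
From HB Require Import structures.
From mathcomp Require Import all_boot all_order all_algebra all_fingroup.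
From mathcomp Require Import all_classical all_reals all_analysis.
From mathcomp Require Import measurable_realfun ring lra.

(** Let [V] be the [m] by [n] matrix whose columns form an orthonormal basis of
    [E]. Then [V^T V = 1]; the rows [v_i] of [V] are the projections of the
    [e_i], written in that basis, and [sum_i v_i^T v_i = 1], so the [v_i] form a
    tight frame. In the same coordinates the projected ball is the unit ball
    [B] of [R^n], and the projection of its nonnegative part is
    [L = {sum_i lam_i v_i : lam_i >= 0, |lam| <= 1}]
    ([lebesgue_on_oproj], [linear_image_ball], [orthant_image]).

    The inequality [vol B <= 2^n vol L] is a reverse Brascamp-Lieb inequality
    for half-Gaussians, proved by transport as Barthe does. Put
    [c_i = |v_i|^2], [u_i = v_i / |v_i|] and [y_i = <y, u_i>]. There is an
    increasing [phi : R -> (0, oo)] such that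
    [phi'(t) = exp (phi(t)^2 - t^2) / 2] ([half_gauss_transport]). The map
    [Phi(y) = sum_i |v_i| phi(y_i) v_i] is injective because it is monotone
    ([comb_inj]), its Jacobian matrix is [sum_i phi'(y_i) v_i^T v_i], and
    [Phi(y)] lies in [s L] as soon as [sum_i c_i phi(y_i)^2 <= s^2]. Integrating
    over the levels of [exp (- sum_i c_i phi(y_i)^2)] gives
    [int det(DPhi) exp (- sum_i c_i phi(y_i)^2) dy <= Gamma vol L]
    ([integral_jac_weight_le]), where the constant [Gamma] is the one for which
    [int exp (- |y|^2) dy = Gamma vol B] ([integral_gauss_ball]).
    On the other side, the Cauchy-Binet formula and the weighted
    arithmetic-geometric mean inequality give
    [det (sum_i t_i v_i^T v_i) >= prod_i t_i^c_i] ([det_wgram_ge]). Since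
    [sum_i c_i y_i^2 = |y|^2] and [sum_i c_i = n], the integrand on the left is
    at least [2^-n exp (- |y|^2)] ([jac_weight_ge]), and the inequality follows.

    Only linear changes of variables enter ([vol_linear]). If [phi] is replaced
    by its piecewise affine interpolant on a grid, then [Phi] becomes affine on
    finitely many pieces and stays injective, which bounds the sum of the
    volumes of the images ([vol_affine_pieces], [grid_sum_le]); refining the
    grid and using Fatou's lemma gives the bound for [Phi] ([jac_level_le]).

    If the volumes are equal, then the arithmetic-geometric mean inequality is
    an equality on a dense set of [y], hence everywhere ([vol_ball_eq_dense],
    [tau_sum_minor]): the sum of [ln phi'(y_i)] over a basis extracted from the
    rows of [V] does not depend on the basis. Exchanging one basis vector [v_k]
    for another nonzero row [v_i] yields [phi'(y_i) = phi'(y_k)] for all [y],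
    and this forces [u_i = u_k] ([tau_inj]). So each nonzero row is a positive
    multiple of one of [n] unit vectors, and [V^T V = 1] makes these
    orthonormal ([exists_adapted_basis]). Conversely, if the coordinates of all
    [v_i] in some orthonormal basis are nonnegative, then [L] is the nonnegative
    part of [B] in that basis, and [B] is made of [2^n] reflections of it
    ([adapted_basis_vol]). Hence equality holds if and only if there is an
    orthogonal [W] such that [V W^T] has no negative entry
    ([vol_ball_eq_orthant_image]). The columns of [V W^T] are then the vectors
    [w_j]: they are nonnegative and orthonormal, so their supports are disjoint,
    and these supports are the sets [U_j]. *)

Set Implicit Arguments.
Unset Strict Implicit.
Unset Printing Implicit Defensive.

Import Order.TTheory GRing.Theory Num.Theory.
Import numFieldNormedType.Exports.

Local Open Scope classical_set_scope.
Local Open Scope ring_scope.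

(** * Lebesgue measure on row vectors and linear maps *)

Section volume.
Context {R : realType}.
Local Notation leb := (@lebesgue_measure R).
Local Notation tup n := (n.-tuple (measurableTypeR R)).

Lemma lebesgue_measure_unique_scale (a : {nonneg R})
    (nu : {measure set (measurableTypeR R) -> \bar R}) :
  (forall X, ocitv X -> leb X = (a%:num%:E * nu X)%E) ->
  forall A, measurable A -> leb A = (a%:num%:E * nu A)%E.
Proof.
by move=> H A mA; apply: (lebesgue_measure_unique (mu := mscale a nu)).
Qed.

Lemma lebesgue_measure_affine_pos (a b : R) (A : set (measurableTypeR R)) :
  0 < a -> measurable A ->
  leb ((fun x => x * a + b) @^-1` A) = (a^-1%:E * leb A)%E.
Proof.
move=> a0 mA.
have mf : measurable_fun setT
    ((fun x => x * a + b) : measurableTypeR R -> measurableTypeR R).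
  apply: measurable_funD => //; apply: measurable_funM => //.
have -> : leb A = ((NngNum (ltW a0))%:num%:E * pushforward leb
    ((fun x => x * a + b)%R : measurableTypeR R -> measurableTypeR R) A)%E.
  apply: lebesgue_measure_unique_scale => // X [[u v]] _ <-.
  rewrite /= /pushforward.
  rewrite (_ : _ @^-1` _ = `](u - b) / a, (v - b) / a]%classic); last first.
    apply/seteqP; split => x /=; rewrite !in_itv/= ltr_pdivrMr// ler_pdivlMr//.
      by case/andP => ? ?; apply/andP; split; lra.
    by case/andP => ? ?; apply/andP; split; lra.
  rewrite !lebesgue_measure_itv/= !lte_fin ltr_pM2r ?invr_gt0// ltrD2r.
  case: ifPn => _; last by rewrite mule0.
  by rewrite -!EFinD -EFinM; congr EFin; field; rewrite gt_eqF.
by rewrite /pushforward muleA -EFinM mulVf ?gt_eqF// mul1e.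
Qed.

Lemma lebesgue_measure_affine (a b : R) (A : set (measurableTypeR R)) :
  a != 0 -> measurable A ->
  (`|a|%:E * leb ((fun x => x * a + b)%R @^-1` A))%E = leb A.
Proof.
move=> a0 mA; have [an|ap|] := ltgtP a 0; last by move/eqP: a0.
- rewrite -(lebesgue_measureN mA) /pushforward ltr0_norm//.
  have -> : (fun x => x * a + b) @^-1` A
      = (fun x => x * (- a) + (- b)) @^-1` ((-%R : R -> R) @^-1` A).
    by apply/seteqP; split => x /=; rewrite opprD mulrN !opprK.
  rewrite lebesgue_measure_affine_pos ?oppr_gt0//.
    by rewrite muleA -EFinM mulfV ?mul1e// oppr_eq0.
  by rewrite -[X in measurable X]setTI; exact: (@oppr_measurable R setT).
- rewrite gtr0_norm// lebesgue_measure_affine_pos//.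
  by rewrite muleA -EFinM mulfV ?mul1e.
Qed.

Definition rowt n (t : tup n) : 'rV[R]_n := \row_j tnth t j.
Definition trow n (x : 'rV[R]_n) : tup n := [tuple x 0 j | j < n].
(** Row vectors carry the linear algebra, tuples carry the Borel structure
    and the product measure; measurability and volume of a set of row vectors
    are those of its preimage. *)
Definition rvmeasurable n (A : set 'rV[R]_n) := measurable (@rowt n @^-1` A).
Definition vol n (A : set 'rV[R]_n) : \bar R := lebesgue_tuple n (@rowt n @^-1` A).

Lemma trowK n : cancel (@trow n) (@rowt n).
Proof. by move=> x; apply/rowP => i; rewrite mxE tnth_mktuple. Qed.

Lemma measurable_coord n (j : 'I_n) :
  measurable_fun setT (fun t : tup n => rowt t 0 j).
Proof.
rewrite (_ : (fun t : tup n => rowt t 0 j) = (fun t => tnth t j)); first exact: measurable_tnth.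
by apply/funext => t; rewrite mxE.
Qed.

Lemma measurable_linear n p (M : 'M[R]_(n, p)) (j : 'I_p) :
  measurable_fun setT (fun t : tup n => (rowt t *m M) 0 j).
Proof.
under eq_fun do rewrite mxE.
apply: measurable_sum => i; apply: measurable_funM => //.
exact: measurable_coord.
Qed.

Lemma rvmeasurable_preimage n p (f : 'rV[R]_n -> 'rV[R]_p) (A : set 'rV[R]_p) :
  (forall j, measurable_fun setT (fun t : tup n => f (rowt t) 0 j)) ->
  rvmeasurable A -> rvmeasurable (f @^-1` A).
Proof.
move=> mf mA; rewrite /rvmeasurable.
have -> : @rowt n @^-1` (f @^-1` A)
    = (fun t => trow (f (rowt t))) @^-1` (@rowt p @^-1` A).
  by apply/seteqP; split => t /=; rewrite trowK.
rewrite -[X in measurable X]setTI.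
have H : measurable_fun setT (fun t : tup n => trow (f (rowt t))).
  apply/measurable_fun_tnthP => i /=.
  have E : (fun t => f (rowt t) 0 i) = (fun t => tnth (trow (f (rowt t))) i).
    by apply/funext => t; rewrite tnth_mktuple.
  by have := mf i; rewrite E.
exact: H.
Qed.

Lemma rvmeasurable_affine n p (M : 'M[R]_(n, p)) c (A : set 'rV[R]_p) :
  rvmeasurable A -> rvmeasurable ((fun x => x *m M + c) @^-1` A).
Proof.
apply: rvmeasurable_preimage => j; under eq_fun do rewrite mxE.
by apply: measurable_funD => //; exact: measurable_linear.
Qed.

Lemma rvmeasurable_linear n p (M : 'M[R]_(n, p)) (A : set 'rV[R]_p) :
  rvmeasurable A -> rvmeasurable ((fun x => x *m M) @^-1` A).
Proof. by apply: rvmeasurable_preimage => j; exact: measurable_linear. Qed.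

Lemma rvmeasurable_translation n (c : 'rV[R]_n) (A : set 'rV[R]_n) :
  rvmeasurable A -> rvmeasurable ((fun x => x + c) @^-1` A).
Proof.
move=> mA; have := rvmeasurable_affine 1%:M c mA.
by congr rvmeasurable; apply/seteqP; split => x /=; rewrite mulmx1.
Qed.

Lemma rowt_tcons n (x : R) (t : tup n) :
  rowt (tcons (x, t)) = row_mx (x%:M : 'rV_1) (rowt t) :> 'rV_(1 + n).
Proof.
apply/rowP => i; rewrite mxE; case: (splitP i) => j ij.
  have -> : i = lshift n j by apply: val_inj.
  by rewrite row_mxEl ord1 mxE eqxx mulr1n (tnth_nth 0)/=.
have -> : i = rshift 1 j by apply: val_inj.
by rewrite row_mxEr mxE /= (tnth_nth 0)/= -tnth_nth.
Qed.

Lemma measurable_tcons_preimage n (A : set 'rV[R]_(1 + n)) :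
  rvmeasurable A -> measurable ((@tcons _ _ n) @^-1` (@rowt (1 + n) @^-1` A)).
Proof.
move=> mA; rewrite -[X in measurable X]setTI; exact: measurable_tcons.
Qed.

(** Integration with the first coordinate outermost is how the measure is
    built; [vol_snd] is the opposite order of integration. *)
Lemma vol_fst n (A : set 'rV[R]_(1 + n)) :
  vol A = (\int[leb]_x vol [set y | A (row_mx (x%:M : 'rV_1) y)])%E.
Proof.
rewrite /vol /= /cons_measure /pushforward /product_measure1.
apply: eq_integral => x _ /=; congr (lebesgue_tuple _ _).
by apply/seteqP; split => t /=; rewrite /xsection/= inE/= rowt_tcons.
Qed.

Lemma vol_snd n (A : set 'rV[R]_(1 + n)) : rvmeasurable A ->
  vol A = (\int[lebesgue_tuple n]_t
             leb [set x | A (row_mx (x%:M : 'rV_1) (rowt t))])%E.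
Proof.
move=> mA; rewrite /vol /= /cons_measure /pushforward.
rewrite (product_measure_unique (m' := product_measure2 leb (lebesgue_tuple n))); last 2 first.
- by move=> B C mB mC; rewrite /= product_measure2E.
- exact: measurable_tcons_preimage.
apply: eq_integral => t _ /=; congr (leb _).
by apply/seteqP; split => x /=; rewrite /ysection/= inE/= rowt_tcons.
Qed.

Lemma rvmeasurable_section_fst n (A : set 'rV[R]_(1 + n)) x : rvmeasurable A ->
  rvmeasurable [set y | A (row_mx (x%:M : 'rV_1) y)].
Proof.
move=> /measurable_tcons_preimage /(measurable_xsection x).
by congr measurable; apply/seteqP; split => t /=; rewrite /xsection/= inE/= rowt_tcons.
Qed.

Lemma rvmeasurable_section_snd n (A : set 'rV[R]_(1 + n)) y : rvmeasurable A ->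
  measurable ([set x | A (row_mx (x%:M : 'rV_1) y)] : set (measurableTypeR R)).
Proof.
move=> /measurable_tcons_preimage /(measurable_ysection (trow y)).
by congr measurable; apply/seteqP; split => t /=; rewrite /ysection/= inE/= rowt_tcons trowK.
Qed.

Lemma measurable_vol_section n (A : set 'rV[R]_(1 + n)) : rvmeasurable A ->
  measurable_fun setT (fun x : measurableTypeR R => vol [set y | A (row_mx (x%:M : 'rV_1) y)]).
Proof.
move=> /measurable_tcons_preimage mA.
have := measurable_fun_xsection (lebesgue_tuple n) mA.
congr measurable_fun; apply/funext => x /=; congr (lebesgue_tuple _ _).
by apply/seteqP; split => t /=; rewrite /xsection/= inE/= rowt_tcons.
Qed.

Lemma measurable_leb_section n (A : set 'rV[R]_(1 + n)) : rvmeasurable A ->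
  measurable_fun setT (fun t : tup n => leb [set x | A (row_mx (x%:M : 'rV_1) (rowt t))]).
Proof.
move=> /measurable_tcons_preimage mA.
have := measurable_fun_ysection leb mA.
congr measurable_fun; apply/funext => x /=; congr (leb _).
by apply/seteqP; split => t /=; rewrite /ysection/= inE/= rowt_tcons.
Qed.

(** Only the first coordinate moves, so in each fibre this is the one-
    dimensional scaling by [a], followed by a translation that depends on the
    other coordinates. *)
Lemma vol_affine_fst n (a b : R) (c : 'cV[R]_n) (A : set 'rV[R]_(1 + n)) :
  a != 0 -> rvmeasurable A ->
  (`|a|%:E * vol ((fun x => x *m block_mx a%:M 0 c 1%:M
     + row_mx (b%:M : 'rV_1) 0)%R @^-1` A))%E = vol A.
Proof.
move=> a0 mA; rewrite vol_snd; last exact: rvmeasurable_affine.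
rewrite vol_snd// -ge0_integralZl//; last first.
  by apply: measurable_leb_section; exact: rvmeasurable_affine.
apply: eq_integral => t _.
apply: etrans (@lebesgue_measure_affine a
  ((rowt t *m c) 0 0 + b) _ a0 (rvmeasurable_section_snd (rowt t) mA)).
congr (_ * leb _)%E; apply/funext => x /=; congr (A _).
rewrite mul_row_block add_row_mx mulmx0 add0r addr0 mulmx1 -scalar_mxM.
by rewrite [rowt t *m c in LHS]mx11_scalar addrA -!raddfD.
Qed.

Lemma vol_translation n (c : 'rV[R]_n) (A : set 'rV[R]_n) : rvmeasurable A ->
  vol ((fun x => x + c) @^-1` A) = vol A.
Proof.
elim: n c A => [|n IH] c A mA.
  by congr vol; apply/seteqP; split => x /=; rewrite [c]thinmx0 addr0.
pose b := lsubmx (c : 'rV_(1 + n)); pose d := rsubmx (c : 'rV_(1 + n)).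
have -> : c = row_mx b d by rewrite /b /d (@hsubmxK _ 1 1 n c).
have -> : (fun x => x + (row_mx b d : 'rV_n.+1)) @^-1` A =
  (fun x => x *m block_mx (1%:M : 'M[R]_1) 0 0 (1%:M : 'M[R]_n)
     + row_mx ((b 0 0)%:M : 'rV_1) 0) @^-1`
   ((fun x => x + (row_mx 0 d : 'rV_(1 + n))) @^-1` A).
  apply/seteqP; split => x /=; rewrite -scalar_mx_block mulmx1 -addrA add_row_mx;
   by rewrite add0r addr0 -mx11_scalar.
rewrite -[LHS]mul1e -[X in X%:E]normr1 (@vol_affine_fst n 1) ?oner_eq0//; last first.
  exact: (@rvmeasurable_translation (1 + n)).
rewrite (@vol_fst n) [RHS](@vol_fst n); apply: eq_integral => x _.
rewrite -[RHS](IH d); last exact: rvmeasurable_section_fst.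
by congr vol; apply/seteqP; split => y /=; rewrite add_row_mx addr0.
Qed.

(** The change of variables formula for [M]. It is stable under products and
    holds for the block triangular matrices with one block of size one, which
    is enough to reach every invertible matrix. *)
Definition scales_vol n (M : 'M[R]_n) := forall A : set 'rV[R]_n, rvmeasurable A ->
  (`|\det M|%:E * vol ((fun x => x *m M)%R @^-1` A))%E = vol A.

Lemma scales_volM n (M N : 'M[R]_n) :
  scales_vol M -> scales_vol N -> scales_vol (M *m N).
Proof.
move=> hM hN A mA; rewrite -[RHS](hN A mA) -(hM _ (rvmeasurable_linear N mA)).
rewrite det_mulmx normrM mulrC EFinM -muleA; congr (_ * (_ * vol _))%E.
by apply/seteqP; split => x /=; rewrite mulmxA.
Qed.

Lemma scales_vol_lower n (a : R) (c : 'cV[R]_n) :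
  a != 0 -> scales_vol (block_mx a%:M 0 c 1%:M : 'M[R]_(1 + n)).
Proof.
move=> a0 A mA; rewrite det_lblock det1 mulr1 det_scalar expr1.
rewrite -[RHS](vol_affine_fst 0 c a0 mA); congr (_ * vol _)%E.
by apply/seteqP; split => x /=; rewrite raddf0 row_mx0 addr0.
Qed.

Lemma scales_vol_upper n (r : 'rV[R]_n) (D : 'M[R]_n) :
  scales_vol D -> scales_vol (block_mx 1%:M r 0 D : 'M[R]_(1 + n)).
Proof.
move=> hD A mA; rewrite det_ublock det1 mul1r !vol_fst -ge0_integralZl//; last first.
  by apply: measurable_vol_section; exact: rvmeasurable_linear.
apply: eq_integral => x _; have mB := rvmeasurable_section_fst x mA.
apply: etrans (vol_translation (x *: r) mB).
rewrite -(hD _ (rvmeasurable_translation (x *: r) mB)).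
congr (_ * vol _)%E; apply/funext => y /=; congr (A _).
by rewrite mul_row_block mulmx0 addr0 mulmx1 mul_scalar_mx addrC.
Qed.

Lemma scales_vol1 n : scales_vol (1%:M : 'M[R]_n).
Proof.
move=> A mA; rewrite det1 normr1 mul1e; congr vol.
by apply/seteqP; split => x /=; rewrite mulmx1.
Qed.

Lemma scales_vol_block n (a : R) (r : 'rV[R]_n) (c : 'cV[R]_n) (D : 'M[R]_n) :
  (forall M : 'M[R]_n, M \in unitmx -> scales_vol M) -> a != 0 ->
  block_mx a%:M r c D \in unitmx -> scales_vol (block_mx a%:M r c D).
Proof.
move=> IH a0; set D' := D - c *m (a^-1 *: r).
have -> : block_mx a%:M r c D
    = block_mx a%:M 0 c 1%:M *m block_mx 1%:M (a^-1 *: r) 0 D'.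
  rewrite mulmx_block !mul0mx !mulmx0 !mulmx1 !mul1mx !addr0.
  by rewrite mul_scalar_mx scalerA divff// scale1r /D' addrC subrK.
rewrite unitmx_mul => /andP[_ uD]; apply: scales_volM.
  exact: scales_vol_lower.
apply/scales_vol_upper/IH; move: uD.
by rewrite !unitmxE det_ublock det1 mul1r.
Qed.

(** If the upper left entry is nonzero, a block LU factorization reduces the
    dimension by one; otherwise a shear first brings a nonzero entry of the
    first column into that position. *)
Lemma vol_linear n (M : 'M[R]_n) : M \in unitmx -> scales_vol M.
Proof.
elim: n M => [|n IH] M uM.
  have -> : M = 1%:M by rewrite [M]flatmx0 [RHS]flatmx0.
  exact: scales_vol1.
have [i Mi0] : exists i, M i 0 != 0.
  apply/existsP; apply: contraTT uM; rewrite negb_exists => /forallP M0.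
  rewrite unitmxE (expand_det_col M 0) big1 ?unitr0// => i _.
  by have /negPn/eqP -> := M0 i; rewrite mul0r.
have blockE (N : 'M[R]_(1 + n)) : N = block_mx (N 0 0)%:M (ursubmx N) (dlsubmx N) (drsubmx N).
  rewrite -[LHS]submxK; congr (block_mx _ _ _ _).
  by rewrite [LHS]mx11_scalar; congr (_%:M); rewrite !mxE; congr (N _ _); exact: val_inj.
have [M00|M00] := eqVneq (M 0 0) 0; last first.
  by rewrite [M]blockE; apply: scales_vol_block => //; rewrite -blockE.
case: (unliftP 0 i) Mi0 => [j ->|->]; last by rewrite M00 eqxx.
move=> Mj0; pose S (s : R) : 'M[R]_(1 + n) := block_mx 1%:M (s *: delta_mx 0 j) 0 1%:M.
have uS s : S s \in unitmx by rewrite unitmxE det_ublock !det1 mulr1 unitr1.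
have SM00 : (S 1 *m M) 0 0 = M (lift 0 j) 0.
  have l0 : lshift n (0 : 'I_1) = 0 by exact: val_inj.
  have rj k : rshift 1 k = lift 0 k :> 'I_(1 + n) by exact: val_inj.
  rewrite mxE (@big_split_ord _ _ _ 1 n)/= big_ord1 l0 M00 mulr0 add0r.
  rewrite (bigD1 j)//= big1 ?addr0 => [|k kj]; rewrite -{1}l0 /S block_mxEur !mxE.
    by rewrite !eqxx mulr1 mul1r rj.
  by rewrite (negbTE kj) andbF mulr0 mul0r.
(* Adding row [lift 0 j] to row [0] is undone by the shear with coefficient
   [-1]. *)
have -> : M = S (-1) *m (S 1 *m M).
  rewrite mulmxA /S mulmx_block !mul0mx !mulmx0 !mulmx1 !mul1mx !addr0 add0r.
  by rewrite -scalerDl addrN scale0r -scalar_mx_block mul1mx.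
apply: scales_volM; first exact/scales_vol_upper/scales_vol1.
rewrite [_ *m _]blockE; apply: scales_vol_block => //; rewrite -?blockE ?SM00//.
by rewrite unitmx_mul uS.
Qed.

End volume.

Section pieces.
Context {R : realType} {n : nat}.

Lemma vol_affine_image (M : 'M[R]_n) b (C : set 'rV[R]_n) :
  M \in unitmx -> rvmeasurable C ->
  rvmeasurable ((fun x => (x - b) *m invmx M) @^-1` C) /\
  vol ((fun x => (x - b) *m invmx M) @^-1` C) = (`|\det M|%:E * vol C)%E.
Proof.
move=> uM mC.
have e : (fun x => (x - b) *m invmx M) @^-1` C =
    (fun x => x - b) @^-1` ((fun x => x *m invmx M) @^-1` C) by [].
have mC' := rvmeasurable_linear (invmx M) mC.
rewrite e; split; first exact: rvmeasurable_translation.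
rewrite vol_translation// -(vol_linear uM mC').
congr (_ * vol _)%E; apply/funext => x /=; congr (C _).
by rewrite mulmxK.
Qed.

(** One inequality of the change of variables formula, for an injective map
    into [L] that is affine on finitely many pieces: the images of the pieces
    are disjoint. *)
Lemma vol_affine_pieces (K : finType) (C : K -> set 'rV[R]_n)
    (M : K -> 'M[R]_n) (b : K -> 'rV[R]_n) (L : set 'rV[R]_n) :
  (forall k, M k \in unitmx) -> (forall k, rvmeasurable (C k)) -> rvmeasurable L ->
  (forall k x, C k x -> L (x *m M k + b k)) ->
  (forall k k' x x', C k x -> C k' x' ->
     x *m M k + b k = x' *m M k' + b k' -> k = k') ->
  (\sum_k `|\det (M k)|%:E * vol (C k) <= vol L)%E.
Proof.
move=> uM mC mL CL Cinj.
pose I k := (fun x => (x - b k) *m invmx (M k)) @^-1` C k.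
have Isurj k x : I k x -> exists2 y, C k y & x = y *m M k + b k.
  by move=> Ix; exists ((x - b k) *m invmx (M k)); rewrite // mulmxKV// subrK.
under eq_bigr => k _ do rewrite -(vol_affine_image (b k) (uM k) (mC k)).2.
have -> : (\sum_k vol (I k) = vol (\bigcup_(k in [set: K]) I k))%E.
  rewrite /vol preimage_bigcup measure_fin_bigcup//.
  - rewrite fsbig_seq ?index_enum_uniq//; apply: eq_fsbigl.
    by apply/seteqP; split => k //= _; rewrite mem_index_enum.
  - exact: finite_finset.
  - apply/trivIsetP => k k' _ _ kk'; apply/seteqP; split => // t [].
    move=> /Isurj[y Cy ye] /Isurj[y' Cy' ye'].
    by move: kk'; rewrite (Cinj _ _ _ _ Cy Cy' (etrans (esym ye) ye')) eqxx.
  - by move=> k _; exact: (vol_affine_image (b k) (uM k) (mC k)).1.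
apply: le_measure; rewrite ?inE//.
  rewrite preimage_bigcup; apply: fin_bigcup_measurable => [|k _]; first exact: finite_finset.
  exact: (vol_affine_image (b k) (uM k) (mC k)).1.
by move=> t [k _ /Isurj[y Cy ye]]; rewrite /= ye; exact: CL.
Qed.

Lemma rvmeasurable_scale (h : R) (L : set 'rV[R]_n) : 0 < h -> rvmeasurable L ->
  rvmeasurable [set h *: x | x in L].
Proof.
move=> h0 mL.
have -> : [set h *: x | x in L] = (fun x => x *m (h^-1)%:M) @^-1` L.
  apply/seteqP; split => x /=.
    by case=> y Ly <-; rewrite mul_mx_scalar scalerA mulVf ?scale1r ?gt_eqF.
  move=> Lx; exists (x *m (h^-1)%:M) => //.
  by rewrite mul_mx_scalar scalerA mulfV ?scale1r ?gt_eqF.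
exact: rvmeasurable_linear.
Qed.

Lemma vol_scale (h : R) (L : set 'rV[R]_n) : 0 < h -> rvmeasurable L ->
  vol [set h *: x | x in L] = ((h ^+ n)%:E * vol L)%E.
Proof.
move=> h0 mL.
have uh : (h%:M : 'M[R]_n) \in unitmx.
  by rewrite unitmxE det_scalar unitrX// unitfE gt_eqF.
have [_ e] := vol_affine_image 0 uh mL.
rewrite det_scalar ger0_norm ?exprn_ge0 ?ltW// in e; rewrite -e; congr vol.
apply/seteqP; split => x /=; rewrite subr0.
  case=> y Ly <-; congr (L _): Ly.
  by rewrite -mul_mx_scalar mulmxK.
by move=> Lx; exists (x *m invmx h%:M) => //; rewrite -mul_mx_scalar mulmxKV.
Qed.

End pieces.

(** * Determinants of weighted Gram matrices *)

Section gram.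
Context {R : realFieldType} {m n : nat} (V : 'M[R]_(m, n)).

(** This is [V^T D V], where [D] is the diagonal matrix of the weights [t]:
    the sum of the rank one matrices [t_i v_i^T v_i]. *)
Definition wgram (t : 'I_m -> R) : 'M[R]_n :=
  \matrix_(a, b) \sum_i t i * (V i a * V i b).

Definition minor (f : {ffun 'I_n -> 'I_m}) : R := \det (\matrix_(k, l) V (f k) l).

Lemma det_wgram_expand t :
  \det (wgram t) = \sum_(f : {ffun 'I_n -> 'I_m})
    (\prod_k t (f k)) * ((\prod_k V (f k) k) * minor f).
Proof.
rewrite /determinant.
under eq_bigr => s _.
  under eq_bigr => k _ do rewrite mxE.
  rewrite bigA_distr_bigA/= big_distrr/=.
  over.
rewrite exchange_big/=; apply: eq_bigr => f _.
rewrite /minor /determinant !big_distrr/=; apply: eq_bigr => s _.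
rewrite !big_split/= [X in _ = _ * (_ * (_ * X))](_ : _ = \prod_k V (f k) (s k)).
  have mulE (a b c d : R) : a * (b * (c * d)) = b * (c * (a * d)).
    by rewrite (mulrCA a) (mulrCA a).
  exact: mulE.
by apply: eq_bigr => k _; rewrite mxE.
Qed.

Lemma minor_perm (f : {ffun 'I_n -> 'I_m}) (s : 'S_n) :
  minor [ffun k => f (s k)] = (-1) ^+ s * minor f.
Proof.
rewrite /minor -det_perm -det_mulmx; congr (\det _).
by rewrite -row_permE; apply/matrixP => k l; rewrite !mxE ffunE.
Qed.

(** The Cauchy-Binet formula. Summing over all maps [f] rather than over
    subsets counts each basis [n!] times and kills the non-injective maps,
    whose minor vanishes. It follows from [det_wgram_expand] by averaging
    over the permutations of the arguments of [f]. *)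
Lemma det_wgram t : (n`!)%:R * \det (wgram t) =
  \sum_(f : {ffun 'I_n -> 'I_m}) (\prod_k t (f k)) * minor f ^+ 2.
Proof.
rewrite det_wgram_expand -card_Sn -sum1_card natr_sum big_distrl/=.
have reidx (s : 'S_n) (F : {ffun 'I_n -> 'I_m} -> R) :
    \sum_f F f = \sum_(f : {ffun 'I_n -> 'I_m}) F [ffun k => f (s k)].
  pose h (u : 'S_n) (f : {ffun 'I_n -> 'I_m}) := [ffun k => f (u k)].
  apply: (reindex (h s)); exists (h (s^-1)%g) => f _; apply/ffunP => k.
    by rewrite !ffunE permKV.
  by rewrite !ffunE permK.
under eq_bigr => s _ do rewrite mul1r (reidx s).
rewrite exchange_big/=; apply: eq_bigr => f _.
have mE : minor f = \sum_(s : 'S_n) (-1) ^+ s * \prod_k V (f (s k)) k.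
  rewrite /minor -det_tr /determinant; apply: eq_bigr => s _.
  by congr (_ * _); apply: eq_bigr => k _; rewrite !mxE.
rewrite expr2 mulrA {2}mE big_distrr/=.
apply: eq_bigr => s _; rewrite minor_perm.
have -> : \prod_k t ([ffun k => f (s k)] k) = \prod_k t (f k).
  rewrite [RHS](reindex_inj (@perm_inj _ s))/=.
  by apply: eq_bigr => k _; rewrite ffunE.
have -> : \prod_k V ([ffun k => f (s k)] k) k = \prod_k V (f (s k)) k.
  by apply: eq_bigr => k _; rewrite ffunE.
by rewrite -mulrA; congr (_ * _); rewrite mulrC -mulrA [RHS]mulrCA.
Qed.

Lemma minor_eq0 (f : {ffun 'I_n -> 'I_m}) k l :
  k != l -> f k = f l -> minor f = 0.
Proof.
by move=> kl fkl; apply: (determinant_alternate kl) => j; rewrite !mxE fkl.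
Qed.

(** The block matrix with rows [1, -u] and [u^T, 1] has two triangular
    factorizations, which give the two sides. *)
Lemma det_1Drank1 (u : 'rV[R]_n) : \det (1%:M + u^T *m u) = 1 + (u *m u^T) 0 0.
Proof.
pose P := block_mx (1%:M : 'M[R]_1) (- u) u^T 1%:M.
have P1 : P = block_mx 1%:M 0 u^T 1%:M *m block_mx 1%:M (- u) 0 (1%:M + u^T *m u).
  rewrite /P mulmx_block !mul0mx !mulmx0 !mulmx1 !mul1mx !addr0.
  by rewrite mulmxN addrCA addNr addr0.
have P2 : P = block_mx 1%:M (- u) 0 1%:M *m block_mx (1%:M + u *m u^T) 0 u^T 1%:M.
  rewrite /P mulmx_block !mul0mx !mulmx0 !mulmx1 !mul1mx ?addr0 !add0r.
  by rewrite mulNmx addrK.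
have := congr1 determinant P1.
rewrite P2 !det_mulmx !det_lblock !det_ublock !det1 !mul1r !mulr1 => <-.
by rewrite det_mx11 !mxE eqxx.
Qed.

End gram.

Section frame.
Context {R : realType} {m n : nat} (V : 'M[R]_(m, n)) (V1 : V^T *m V = 1%:M).

Definition rownorm2 i : R := \sum_a V i a ^+ 2.

Lemma wgram1 : wgram V (fun=> 1) = 1%:M.
Proof.
rewrite -V1; apply/matrixP => a b; rewrite !mxE; apply: eq_bigr => i _.
by rewrite mxE mul1r.
Qed.

Let nf_gt0 : (0 : R) < (n`!)%:R.
Proof. by rewrite ltr0n fact_gt0. Qed.

Lemma sum_minor2 : \sum_f minor V f ^+ 2 = (n`!)%:R.
Proof.
have := det_wgram V (fun=> 1); rewrite wgram1 det1 mulr1 => ->.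
by apply: eq_bigr => f _; rewrite big1 ?mul1r.
Qed.

(** By [sum_minor2] the numbers [minor V f ^+ 2 / n!] form a probability on
    the bases extracted from the rows; row [i] belongs to the random basis
    with probability [|v_i|^2]. The proof compares the Cauchy-Binet formula
    for the weights [1] and for the weights in which that of row [i] is
    doubled. *)
Lemma sum_minor2_count i :
  \sum_f minor V f ^+ 2 * (\sum_k (f k == i)%:R) = (n`!)%:R * rownorm2 i.
Proof.
apply: (addrI (n`!)%:R); rewrite -[X in _ = X + _]mulr1 -mulrDr.
have <- : \det (wgram V (fun j => 1 + (j == i)%:R)) = 1 + rownorm2 i.
  rewrite (_ : wgram _ _ = 1%:M + (row i V)^T *m row i V).
    rewrite det_1Drank1 mxE; congr (1 + _).
    by apply: eq_bigr => a _; rewrite !mxE expr2.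
  rewrite -wgram1; apply/matrixP => a b; rewrite !mxE big_ord1 !mxE.
  rewrite [X in _ = _ + X](_ : _ = \sum_j (j == i)%:R * (V j a * V j b)).
    by rewrite -big_split/=; apply: eq_bigr => j _; rewrite mulrDl.
  rewrite (bigD1 i)//= big1 ?addr0 ?eqxx ?mul1r// => j /negbTE ->.
  by rewrite mul0r.
rewrite det_wgram -{1}sum_minor2 -big_split/=; apply: eq_bigr => f _.
have [finj|] := boolP (injectiveb f); last first.
  case/injectivePn => k [l kl fkl]; rewrite (minor_eq0 V kl fkl).
  by rewrite expr0n/= mul0r mulr0 addr0.
rewrite -{1}[minor V f ^+ 2]mulr1 -mulrDr mulrC; congr (_ * _).
have [/existsP[k /eqP fk]|] := boolP [exists k, f k == i].
  have nk l : l != k -> (f l == i) = false.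
    by move=> lk; rewrite -fk (inj_eq (injectiveP _ finj)); apply/negbTE.
  rewrite (bigD1 k)//= big1 => [|l /nk ->//].
  rewrite [RHS](bigD1 k)//= big1 => [|l /nk ->]; last by rewrite addr0.
  by rewrite fk eqxx addr0 mulr1.
rewrite negb_exists => /forallP nk.
rewrite !big1 ?addr0// => k _; first by rewrite (negbTE (nk k)) addr0.
by rewrite (negbTE (nk k)).
Qed.

Lemma sum_minor2_weighted (tau : 'I_m -> R) :
  \sum_f minor V f ^+ 2 * (\sum_k tau (f k)) =
  (n`!)%:R * \sum_i rownorm2 i * tau i.
Proof.
rewrite big_distrr/=.
under [RHS]eq_bigr => i _ do rewrite mulrA -sum_minor2_count big_distrl/=.
rewrite exchange_big/=; apply: eq_bigr => f _.
under [RHS]eq_bigr => i _ do rewrite -mulrA.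
rewrite -big_distrr/=; congr (_ * _).
under [RHS]eq_bigr => i _ do rewrite big_distrl/=.
rewrite exchange_big/=; apply: eq_bigr => k _.
rewrite (bigD1 (f k))//= eqxx mul1r big1 ?addr0// => i.
by rewrite eq_sym => /negbTE ->; rewrite mul0r.
Qed.

(** The deviation of a sum over a random basis from its mean. *)
Let gap (tau : 'I_m -> R) (f : {ffun 'I_n -> 'I_m}) :=
  \sum_k tau (f k) - \sum_i rownorm2 i * tau i.

(** Under the probability of [sum_minor2_count] the mean of [gap] is zero, so
    the deficit in the arithmetic-geometric mean inequality is exactly the
    mean of the nonnegative quantity [exp x - 1 - x] at [x = gap]. *)
Lemma det_wgram_expR (tau : 'I_m -> R) :
  (n`!)%:R * (\det (wgram V (expR \o tau))
      / expR (\sum_i rownorm2 i * tau i) - 1) =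
  \sum_f minor V f ^+ 2 * (expR (gap tau f) - 1 - gap tau f).
Proof.
rewrite mulrBr mulr1 mulrA det_wgram -expRN big_distrl/=.
transitivity (\sum_f minor V f ^+ 2 * expR (gap tau f) - (n`!)%:R
              - \sum_f minor V f ^+ 2 * gap tau f).
  rewrite [X in _ = _ - X](_ : _ = 0) ?subr0.
    congr (_ - _); apply: eq_bigr => f _.
    by rewrite /gap expRD expR_sum/= mulrAC mulrC.
  under eq_bigr do rewrite mulrBr.
  by rewrite sumrB sum_minor2_weighted -big_distrl/= sum_minor2 subrr.
by rewrite -sum_minor2 -!sumrB; apply: eq_bigr => f _; rewrite !mulrBr mulr1.
Qed.

Lemma expR_gap_ge0 (x : R) : 0 <= expR x - 1 - x.
Proof. by rewrite -addrA -opprD subr_ge0 expR_ge1Dx. Qed.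

Lemma expR_gap_eq0 (x : R) : expR x - 1 - x = 0 -> x = 0.
Proof.
move=> h; apply/eqP; apply/negPn/negP => /expR_gt1Dx.
by rewrite -subr_gt0 opprD addrA h ltxx.
Qed.

(** The weighted arithmetic-geometric mean inequality applied to the Cauchy-
    Binet formula. *)
Lemma det_wgram_ge (tau : 'I_m -> R) :
  expR (\sum_i rownorm2 i * tau i) <= \det (wgram V (expR \o tau)).
Proof.
rewrite -subr_ge0 -(pmulr_rge0 _ nf_gt0) -[X in _ - X]mul1r.
rewrite -[X in X - _](divfK (lt0r_neq0 (expR_gt0 (\sum_i rownorm2 i * tau i)))).
rewrite -mulrBl mulrA det_wgram_expR mulr_ge0 ?expR_ge0// sumr_ge0// => f _.
by rewrite mulr_ge0 ?sqr_ge0 ?expR_gap_ge0.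
Qed.

Lemma det_wgram_eq (tau : 'I_m -> R) f :
  \det (wgram V (expR \o tau)) = expR (\sum_i rownorm2 i * tau i) ->
  minor V f != 0 -> \sum_k tau (f k) = \sum_i rownorm2 i * tau i.
Proof.
move=> e f0; have := det_wgram_expR tau.
rewrite e divff ?gt_eqF ?expR_gt0// subrr mulr0 => /esym/psumr_eq0P.
move=> /(_ _)/(_ f isT)/eqP; rewrite mulf_eq0 sqrf_eq0 (negbTE f0)/= => h.
apply/eqP; rewrite -subr_eq0; apply/eqP/expR_gap_eq0/eqP/h => g _.
by rewrite mulr_ge0 ?sqr_ge0 ?expR_gap_ge0.
Qed.

End frame.

(** * Transport of a Gaussian to the half-line *)

Section transport.
Context {R : realType}.

(** The integral of the Gaussian over the half-line up to [x]. *)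
Lemma gauss_primitive : exists2 G : R -> R,
  (forall x : R, is_derive x (1 : R) G (expR (- x ^+ 2)))
  & exists M, forall x, G x <= M.
Proof.
pose mu := @lebesgue_measure R.
have igi (A : set (measurableTypeR R)) : measurable A ->
    mu.-integrable A (EFin \o gauss_fun).
  by move=> mA; apply: integrableS integrableT_gauss.
exists (fun x => \int[mu]_(t in `]-oo, x]) gauss_fun t)%R.
  move=> x; have [] := @continuous_FTC1 R gauss_fun -oo%O x (x + 1).
  - by rewrite ltrDl.
  - by apply: igi; exact: measurable_itv.
  - exact: ltNyr.
  - exact: continuous_gauss_fun.
  by move=> df e; rewrite derive1E in e; constructor; rewrite ?e.
exists (\int[mu]_(t in setT) gauss_fun t)%R => x.
apply: fine_le.
- by apply: integrable_fin_num => //; apply: igi; exact: measurable_itv.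
- by apply: integrable_fin_num => //; exact: igi.
apply: ge0_subset_integral => //.
  by apply/measurable_EFinP; exact: measurable_gauss_fun.
by move=> y _; rewrite lee_fin gauss_fun_ge0.
Qed.

Lemma is_derive_continuous (f : R -> R) x d :
  is_derive x (1 : R) f d -> {for x, continuous f}.
Proof. by move=> [df _]; apply/differentiable_continuous/derivable1_diffP. Qed.

Lemma is_derive_gt0_mono (f f' : R -> R) :
  (forall x : R, is_derive x (1 : R) f (f' x)) -> (forall x, 0 < f' x) ->
  {mono f : x y / x <= y}.
Proof.
move=> df f'0; apply/le_mono => x y xy.
have [|c _ e] := MVT xy (fun z _ => df z).
  apply: continuous_subspaceT => z; exact: is_derive_continuous (df z).
by rewrite -subr_gt0 e mulr_gt0// subr_gt0.
Qed.

(** [phi] is the increasing map from the line onto the positive half-line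
    that carries [exp (- t^2) dt] to [2 exp (- s^2) ds]. If [G] is a
    primitive of [exp (- x^2)] with supremum [l], it is determined by [G (phi
    t) = (G t + l) / 2]; as [G - G 0] is odd and bounded by [l - G 0], the
    right-hand side lies strictly between [G 0] and [l], so that it is a
    value of [G] at a positive point. *)
Lemma half_gauss_transport : exists2 phi : R -> R, (forall t, 0 < phi t) &
  forall t : R, is_derive t (1 : R) phi (expR (phi t ^+ 2 - t ^+ 2 - ln 2)).
Proof.
have [F dF [M FM]] := gauss_primitive.
have dFN x : is_derive x (1 : R) (fun t => F (- t)) (- expR (- x ^+ 2)).
  have -> : - expR (- x ^+ 2) = expR (- (- x) ^+ 2) * (- 1) by rewrite sqrrN mulrN1.
  exact: (@is_derive1_comp _ F (fun t => - t)).
have Fsym x : F x + F (- x) = F 0 + F 0.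
  rewrite -[X in _ = _ + F X]oppr0.
  apply: (@is_derive_0_is_cst _ (fun t => F t + F (- t))) => y.
  by have := is_deriveD (dF y) (dFN y); rewrite addrN.
have Fle : {mono F : x y / x <= y}.
  by apply: is_derive_gt0_mono dF _ => x; rewrite expR_gt0.
have Fm := leW_mono Fle; have Finj := inc_inj Fle.
pose l := sup (range F).
have hs : has_sup (range F).
  by split; [exists (F 0), 0|exists M => _ [x _ <-]].
have Fl x : F x < l.
  apply: (@lt_le_trans _ _ (F (x + 1))); first by rewrite Fm ltrDl.
  by apply: sup_upper_bound => //; exists (x + 1).
pose h t := (F t + l) / 2.
have hl t : h t < l by have := Fl t; rewrite /h; lra.
have h0 t : F 0 < h t.
  by have := Fsym t; have := Fl (- t); rewrite /h; lra.
have ex t : exists s, F s = h t.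
  have lh : 0 < l - h t by rewrite subr_gt0.
  have [_ [b _ <-] hb] := sup_adherent lh hs.
  have hb' : h t < F b by rewrite -/l in hb; lra.
  have b0 : 0 <= b by rewrite ltW// -Fm (lt_trans (h0 t)).
  have [||s _ <-] := @IVT R F 0 b (h t) b0; last by exists s.
    by apply: continuous_subspaceT => z; exact: is_derive_continuous (dF z).
  by rewrite ge_min le_max (ltW hb') (ltW (h0 t)) orbT.
pose G y := xget 0 [set x | F x = y].
have FK : cancel F G.
  move=> x; rewrite /G; case: xgetP => [y _ /= /Finj|/(_ x)/(_ erefl)] //.
have GK t : F (G (h t)) = h t.
  by have [s <-] := ex t; rewrite FK.
exists (G \o h) => t /=; first by rewrite -Fm GK.
have dG : is_derive (h t) (1 : R) G (expR (G (h t) ^+ 2)).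
  rewrite -{1}GK -[expR _]invrK -expRN.
  apply: (@is_derive_inverse _ F); last by rewrite gt_eqF ?expR_gt0.
  - by near=> z; exact: FK.
  - by near=> z; exact: is_derive_continuous (dF z).
have dh : is_derive t (1 : R) h (2^-1 * expR (- t ^+ 2)).
  have -> : h = 2^-1 \*: (F + cst l) by apply/funext => z; rewrite /h mulrC.
  by apply: is_derive_eq; rewrite addr0.
have := is_derive1_comp dG dh.
by rewrite -addrA expRD expRB lnK ?posrE// [_ / 2]mulrC.
Unshelve. all: by end_near.
Qed.

End transport.

(** * Interpolation on a grid *)

Section secant.
Context {R : realType} (phi : R -> R).

(** The grid of step [k^-1] on the interval from [-k] to [k], and the affine
    interpolant of [phi] on its cells; [gridi k t] is the index of the cell
    that contains [t], when there is one. As [k] grows, the grid gets finer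
    and covers the whole line. *)
Definition gridl (k : nat) (j : nat) : R := j%:R / k%:R - k%:R.
Definition slope k j := (phi (gridl k j.+1) - phi (gridl k j)) * k%:R.
Definition chord k j t := phi (gridl k j) + slope k j * (t - gridl k j).
Definition gridi (k : nat) (t : R) : nat := Num.truncn (k%:R * (t + k%:R)).

Lemma gridlS k j : (0 < k)%N -> gridl k j.+1 = gridl k j + k%:R^-1.
Proof. by move=> k0; rewrite /gridl -natr1 mulrDl mul1r; ring. Qed.

Lemma gridiP k t j : (0 < k)%N -> - k%:R <= t ->
  (gridl k j <= t < gridl k j.+1) = (gridi k t == j).
Proof.
move=> k0 kt; have k0' : 0 < k%:R :> R by rewrite ltr0n.
rewrite /gridi Num.Theory.truncn_eq; last by rewrite mulr_ge0 ?ler0n//; lra.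
rewrite /gridl lerBlDr ler_pdivrMr// ltrBrDr ltr_pdivlMr//.
by rewrite ![(t + _) * _]mulrC.
Qed.

Lemma gridi_lt k t : (0 < k)%N -> - k%:R <= t < k%:R ->
  (gridi k t < 2 * (k * k))%N.
Proof.
move=> k0 /andP[kt tk]; have k0' : 0 < k%:R :> R by rewrite ltr0n.
have := gridiP (gridi k t) k0 kt; rewrite eqxx => /andP[h _].
rewrite -(ltr_nat R) 2!natrM -(@ltr_pM2r _ k%:R^-1) ?invr_gt0//.
rewrite mulrA mulfK ?gt_eqF//; move: h; rewrite /gridl => h; lra.
Qed.

Hypothesis phi_le : {mono phi : x y / x <= y}.
Let phi_inc := leW_mono phi_le.

Lemma slope_gt0 k j : (0 < k)%N -> 0 < slope k j.
Proof.
move=> k0; rewrite mulr_gt0 ?ltr0n// subr_gt0 phi_inc gridlS//.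
by rewrite ltrDl invr_gt0 ltr0n.
Qed.

Lemma gridl_le k i j : (0 < k)%N -> (i <= j)%N -> gridl k i <= gridl k j.
Proof. by move=> k0 ij; rewrite lerD2r ler_pM2r ?invr_gt0 ?ltr0n// ler_nat. Qed.

(** The interpolant is strictly increasing, within a cell and from one cell
    to another. *)
Lemma chord_lt k i j s t : (0 < k)%N ->
  gridl k i <= s < gridl k i.+1 -> gridl k j <= t < gridl k j.+1 ->
  s < t -> chord k i s < chord k j t.
Proof.
move=> k0 /andP[is_ si] /andP[jt tj] st.
have [e|ij] := eqVneq i j.
  by rewrite e ltrD2l ltr_pM2l ?slope_gt0// ltrD2r.
have {}ij : (i < j)%N.
  rewrite ltn_neqAle ij /= leqNgt; apply/negP => /(gridl_le k0) ji.
  by have := lt_le_trans tj (le_trans ji is_); rewrite ltNge (ltW st).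
apply: (@lt_le_trans _ _ (phi (gridl k i.+1))).
  rewrite /chord -ltrBrDl /slope -mulrA gtr_pMr ?subr_gt0 ?phi_inc; last first.
    by rewrite gridlS// ltrDl invr_gt0 ltr0n.
  rewrite -ltr_pdivlMl ?ltr0n// mulr1 ltrBlDl; move: si; rewrite gridlS//.
apply: (@le_trans _ _ (phi (gridl k j))).
  by rewrite phi_le gridl_le.
by rewrite lerDl mulr_ge0 ?subr_ge0// ltW// slope_gt0.
Qed.

End secant.

Section secant_cvg.
Context {R : realType} (phi : R -> R) (t d : R).
Hypothesis dphi : is_derive t (1 : R) phi d.

(** The end points of the cell straddle [t], so the slope of the chord is a
    convex combination of two difference quotients of [phi] at [t]; [g] below
    is the quotient function, continuous at [t] with value [d]. *)
Lemma secant_near e : 0 < e -> \forall k \near \oo,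
  `|slope phi k (gridi k t) - d| <= e /\
  `|chord phi k (gridi k t) t - phi t| <= e + e.
Proof.
move=> e0; have /is_derive1_caratheodory[g [fE gc gt]] := dphi.
have /cvgrPdist_le/(_ _ e0) := gc; rewrite gt => -[del /= del0 gdel].
near=> k.
have k0 : (0 < k)%N by near: k; exists 1%N.
have k1 : 1 <= k%:R :> R by rewrite ler1n.
have k0' : 0 < k%:R :> R by rewrite ltr0n.
have kt : `|t| < k%:R.
  by near: k; apply: nbhs_infty_gtr.
have kd : k%:R^-1 < del.
  rewrite invf_plt ?posrE//; near: k; exact: nbhs_infty_gtr.
have /andP[kt1 kt2] : - k%:R < t < k%:R by rewrite -ltr_norml.
have := gridiP (gridi k t) k0 (ltW kt1); rewrite eqxx => /andP[].
set j := gridi k t; set A := gridl k j; rewrite gridlS// -/A => At tB.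
have S : slope phi k j = (g (A + k%:R^-1) * (A + k%:R^-1 - t) - g A * (A - t)) * k%:R.
  by rewrite /slope gridlS// -/A -!fE; congr (_ * _); ring.
have gA : `|g A - d| <= e.
  rewrite distrC; apply: gdel => /=; rewrite ger0_norm ?subr_ge0//.
  by apply: le_lt_trans kd; lra.
have gB : `|g (A + k%:R^-1) - d| <= e.
  rewrite distrC; apply: gdel => /=; rewrite distrC ger0_norm; last lra.
  by apply: le_lt_trans kd; lra.
have Sd : `|slope phi k j - d| <= e.
  have -> : slope phi k j - d = ((g (A + k%:R^-1) - d) * (A + k%:R^-1 - t)
     + (g A - d) * (t - A)) * k%:R.
    by rewrite S; field; rewrite gt_eqF.
  rewrite normrM [`|k%:R|]ger0_norm ?ler0n// -ler_pdivlMr//.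
  apply: (le_trans (ler_normD _ _)); rewrite !normrM.
  rewrite [`|A + _ - t|]ger0_norm; last lra.
  rewrite [`|t - A|]ger0_norm; last lra.
  apply: (@le_trans _ _ (e * (A + k%:R^-1 - t) + e * (t - A))).
    by apply: lerD; rewrite ler_wpM2r//; lra.
  by rewrite -mulrDr ler_pM2l//; lra.
split => //.
have -> : chord phi k j t - phi t = ((slope phi k j - d) - (g A - d)) * (t - A).
  have := fE A; rewrite /chord -/A => /eqP; rewrite subr_eq => /eqP ->; ring.
rewrite normrM; apply: (@le_trans _ _ ((e + e) * 1)); last by rewrite mulr1.
apply: ler_pM => //.
  by apply: (le_trans (ler_normB _ _)); exact: lerD.
rewrite ger0_norm; last lra.
have k1' : k%:R^-1 <= 1 :> R by rewrite invf_le1.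
lra.
Unshelve. all: by end_near. Qed.

Lemma slope_cvg : slope phi k (gridi k t) @[k --> \oo] --> d.
Proof.
apply/cvgrPdist_le => e e0; near=> k; rewrite distrC.
by near: k; apply: filterS (secant_near e0) => k [].
Unshelve. all: by end_near. Qed.

Lemma chord_cvg : chord phi k (gridi k t) t @[k --> \oo] --> phi t.
Proof.
apply/cvgrPdist_le => e e0; have e2 : 0 < e / 2 by rewrite divr_gt0.
near=> k; rewrite distrC.
near: k; apply: filterS (secant_near e2) => k [_].
by rewrite -splitr.
Unshelve. all: by end_near. Qed.

End secant_cvg.

(** * Tight frames and the projected orthant *)

Section frame.
Context {R : realType} {m n : nat} (V : 'M[R]_(m, n)).
Hypothesis V1 : V^T *m V = 1%:M.
Local Notation c := (rownorm2 V).

Lemma rownorm2_ge0 i : 0 <= c i.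
Proof. by apply: sumr_ge0 => a _; exact: sqr_ge0. Qed.

Lemma rownorm2_eq0 i : c i = 0 -> row i V = 0.
Proof.
move=> /psumr_eq0P h; apply/rowP => a; rewrite !mxE; apply/eqP.
by rewrite -sqrf_eq0 h// => b _; exact: sqr_ge0.
Qed.

(** The coordinate along the unit vector [v_i / |v_i|]; it is [0] if [v_i =
    0]. *)
Definition dirc i (y : 'rV[R]_n) := (y *m V^T) 0 i / Num.sqrt (c i).

Lemma sqrt_dirc i y : Num.sqrt (c i) * dirc i y = (y *m V^T) 0 i.
Proof.
rewrite /dirc mulrCA; have [c0|c0] := eqVneq (Num.sqrt (c i)) 0.
  move/eqP : c0; rewrite sqrtr_eq0 => c0.
  have /rownorm2_eq0 /rowP r0 : c i = 0 by apply/le_anti; rewrite c0 rownorm2_ge0.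
  rewrite mxE big1 ?mul0r// => a _.
  by have := r0 a; rewrite !mxE => ->; rewrite mulr0.
by rewrite mulfV// mulr1.
Qed.

Lemma dircB i y z : dirc i y - dirc i z = dirc i (y - z).
Proof. by rewrite /dirc mulmxBl !mxE mulrBl. Qed.

Lemma rownorm2_dirc2 i y : c i * dirc i y ^+ 2 = (y *m V^T) 0 i ^+ 2.
Proof. by rewrite -sqrt_dirc [RHS]exprMn sqr_sqrtr// rownorm2_ge0. Qed.

(** Parseval's identity for a tight frame. *)
Lemma sum_dirc2 y : \sum_i c i * dirc i y ^+ 2 = \sum_a y 0 a ^+ 2.
Proof.
under eq_bigr do rewrite rownorm2_dirc2.
have sqE p (z : 'rV[R]_p) : \sum_a z 0 a ^+ 2 = (z *m z^T) 0 0.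
  by rewrite mxE; apply: eq_bigr => a _; rewrite mxE expr2.
by rewrite !sqE trmx_mul trmxK mulmxA -(mulmxA y) V1 mulmx1.
Qed.

Lemma sum_rownorm2 : \sum_i c i = n%:R.
Proof.
rewrite exchange_big/= -[n in RHS]card_ord -sum1_card natr_sum.
apply: eq_bigr => a _; have := congr1 (fun M : 'M[R]_n => M a a) V1.
rewrite !mxE eqxx => <-; apply: eq_bigr => i _; rewrite mxE expr2//.
Qed.

(** The transport map is [comb] of the numbers [phi (dirc V i y)]. *)
Definition comb (p : 'I_m -> R) : 'rV[R]_n := (\row_i (Num.sqrt (c i) * p i)) *m V.

Lemma comb_affine (beta sigma : 'I_m -> R) y :
  comb (fun i => beta i + sigma i * dirc i y) = y *m wgram V sigma + comb beta.
Proof.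
apply/rowP => a; rewrite !mxE.
under [X in _ = X + _]eq_bigr do rewrite mxE big_distrr/=.
rewrite exchange_big -big_split/=; apply: eq_bigr => i _.
rewrite !mxE mulrDr mulrDl addrC; congr (_ + _).
rewrite mulrCA sqrt_dirc mxE big_distrr big_distrl/=.
by apply: eq_bigr => b _; rewrite !mxE; ring.
Qed.

(** A monotone map is injective: the scalar product of [comb p - comb q] with
    [y - z] is a sum of the nonnegative terms [c_i (p_i - q_i) (y_i - z_i)],
    where [y_i] stands for [dirc V i y]. *)
Lemma comb_inj p q y z :
  (forall i, dirc i y < dirc i z -> p i < q i) ->
  (forall i, dirc i z < dirc i y -> q i < p i) ->
  comb p = comb q -> forall i, dirc i y = dirc i z.
Proof.
move=> lt1 lt2 e.
have : \sum_i c i * ((p i - q i) * (dirc i y - dirc i z)) = 0.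
  have : ((comb p - comb q) *m (y - z)^T) 0 0 = 0 by rewrite e subrr mul0mx mxE.
  rewrite /comb -mulmxBl -mulmxA.
  have -> : V *m (y - z)^T = ((y - z) *m V^T)^T by rewrite trmx_mul trmxK.
  rewrite mxE => s0; rewrite -[RHS]s0; apply: eq_bigr => i _.
  rewrite [X in _ = _ * X]mxE -sqrt_dirc dircB !mxE.
  rewrite -mulrBr -{1}(sqr_sqrtr (rownorm2_ge0 i)); ring.
move/psumr_eq0P => h i.
have {h}/eqP : c i * ((p i - q i) * (dirc i y - dirc i z)) = 0.
  apply: h => // j _; rewrite mulr_ge0 ?rownorm2_ge0//.
  case: (ltgtP (dirc j y) (dirc j z)) => [l|l|->].
  - by rewrite ltW// nmulr_rgt0 ?subr_lt0// lt1.
  - by rewrite ltW// pmulr_rgt0 ?subr_gt0// lt2.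
  - by rewrite subrr mulr0.
rewrite mulf_eq0 => /orP[/eqP c0|].
  by rewrite /dirc c0 sqrtr0 invr0 !mulr0.
case: (ltgtP (dirc i y) (dirc i z)) => // l; rewrite mulf_eq0 !subr_eq0.
  by rewrite !lt_eqF// lt1.
by rewrite !gt_eqF// lt2.
Qed.

Definition orthant_image : set 'rV[R]_n := [set x | exists2 lam : 'rV[R]_m,
  (forall i, 0 <= lam 0 i) /\ \sum_i lam 0 i ^+ 2 <= 1 & x = lam *m V].

(** The coefficients [lam_i = |v_i| p_i] satisfy [sum_i lam_i^2 = sum_i c_i
    p_i^2]. *)
Lemma comb_orthant_image p h : 0 < h -> (forall i, 0 <= p i) ->
  \sum_i c i * p i ^+ 2 <= h ^+ 2 -> [set h *: x | x in orthant_image] (comb p).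
Proof.
move=> h0 p0 ph; exists (h^-1 *: comb p); last first.
  by rewrite scalerA mulfV ?scale1r// gt_eqF.
exists (h^-1 *: \row_i (Num.sqrt (c i) * p i)); last by rewrite scalemxAl.
split=> [i|]; first by rewrite !mxE !mulr_ge0 ?sqrtr_ge0// invr_ge0 ltW.
rewrite [X in X <= _](_ : _ = (h ^+ 2)^-1 * \sum_i c i * p i ^+ 2).
  by rewrite ler_pdivrMl ?exprn_gt0// mulr1.
rewrite big_distrr/=; apply: eq_bigr => i _.
by rewrite !mxE !exprMn sqr_sqrtr ?rownorm2_ge0// exprVn.
Qed.

End frame.

(** * Gaussian integrals by layers *)

Section layer_cake.
Context {R : realType} {n : nat}.
Local Notation leb := (@lebesgue_measure R).
Local Notation tup n := (n.-tuple (measurableTypeR R)).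
Variables (b : bool) (w f : tup n -> R).
Hypothesis w0 : forall t, 0 <= w t.
Hypothesis mw : measurable_fun setT w.
Hypothesis mf : measurable_fun setT (f : tup n -> measurableTypeR R).
Hypothesis f01 : forall t, 0 < f t <= 1.

(** The boolean [b] selects weak or strict superlevel sets. The weak ones of
    a Gaussian are closed balls; the strict ones have lower semicontinuous
    indicators, as Fatou's lemma requires. *)
Let A : set (measurableTypeR R * tup n) :=
  [set p | 0 < p.1 < 1 /\ p.1 < f p.2 ?<= if b].

Let mA : measurable A.
Proof.
have -> : A = (fst @^-1` `]0, 1[%classic) `&`
   ((fun p : measurableTypeR R * tup n => (p.1 < f p.2 ?<= if b)) @^-1` [set true]).
  by apply/seteqP; split => p; rewrite /A/= in_itv/=.
apply: measurableI.
  by rewrite -[X in measurable X]setTI; apply: measurable_fst => //; exact: measurable_itv.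
have mf2 : measurable_fun setT (fun p : measurableTypeR R * tup n => f p.2).
  by apply: measurableT_comp.
rewrite -[X in measurable X]setTI; case: (b) => /=.
  by apply: measurable_fun_ler => //.
by apply: measurable_fun_ltr => //.
Qed.

Let F (p : measurableTypeR R * tup n) : \bar R := (w p.2 * \1_A p)%:E.

Let F0 p : (0 <= F p)%E.
Proof. by rewrite lee_fin mulr_ge0. Qed.

Let mF : measurable_fun setT F.
Proof.
apply/measurable_EFinP; apply: measurable_funM; last exact: measurable_indic.
exact: measurableT_comp.
Qed.

Let level (r : measurableTypeR R) :=
  (\int[lebesgue_tuple n]_t (w t * \1_[set t | r < f t ?<= if b] t)%:E)%E.

Let levelE r : 0 < r < 1 ->
  level r = (\int[lebesgue_tuple n]_t F (r, t))%E.
Proof.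
move=> r01; apply: eq_integral => t _; congr (_ * _)%:E.
rewrite !indicE; congr (nat_of_bool _)%:R.
by apply/idP/idP; rewrite !inE/= /A/=; [split|case].
Qed.

Lemma measurable_layer : measurable_fun (`]0%R, 1%R[%classic : set (measurableTypeR R)) level.
Proof.
have := @measurable_fun_fubini_tonelli_F _ _ _ _ _ (lebesgue_tuple n) F mF F0.
move=> /(measurable_funS measurableT
  (@subsetT _ (`]0%R, 1%R[%classic : set (measurableTypeR R)))).
apply: eq_measurable_fun => r; rewrite inE/= in_itv/= => r01.
by rewrite levelE.
Qed.

(** Tonelli's theorem, [f t] being the length of the set of levels below [f
    t]. *)
Lemma layer_cake : (\int[lebesgue_tuple n]_t (w t * f t)%:E =
  \int[leb]_(r in `]0%R, 1%R[) level r)%E.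
Proof.
transitivity (\int[lebesgue_tuple n]_t \int[leb]_r F (r, t))%E.
  apply: eq_integral => t _.
  have mAt : measurable (ysection A t) by exact: measurable_ysection.
  have -> : (fun r => F (r, t)) = (fun r => (w t)%:E * (\1_(ysection A t) r)%:E)%E.
    apply/funext => r; rewrite /F EFinM; congr (_ * _%:E)%E.
    by rewrite !indicE mem_ysection.
  rewrite ge0_integralZl//; last 2 first.
  - by apply/measurable_EFinP; exact: measurable_indic.
  - by rewrite lee_fin.
  rewrite integral_indic// setIT EFinM; congr (_ * _)%E.
  apply/esym.
  have /andP[ft0 ft1] := f01 t.
  have itvE (x : bool) : leb [set` Interval (BRight 0) (BSide x (f t))] = (f t)%:E.
    by rewrite lebesgue_measure_itv/= lte_fin ft0 oppr0 adde0.
  move: ft1; rewrite le_eqVlt => /predU1P[ft1|ft1].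
    have e1 : leb `]0%R, 1%R[%classic = (f t)%:E.
      by rewrite ft1 lebesgue_measure_itv/= lte_fin ltr01 oppr0 adde0.
    rewrite -e1; congr (leb _); apply/seteqP; split => r; rewrite /ysection/= inE/= /A/= in_itv/=.
      by case.
    move=> r01; split=> //; rewrite ft1; case/andP: r01 => _.
    by case: (b) => /=; [exact: ltW|].
  rewrite -(itvE (~~ b)); congr (leb _); apply/seteqP.
  split => r; rewrite /ysection/= inE/= /A/= in_itv/=.
    by case=> /andP[-> _]; case: (b).
  case/andP=> r0 rf; rewrite r0/=; split; last by move: rf; case: (b).
  by apply: le_lt_trans ft1; move: rf; case: (b) => //= /ltW.
rewrite -(@fubini_tonelli _ _ _ _ _ leb (lebesgue_tuple n) F mF F0) [RHS]integral_mkcond.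
apply: eq_integral => r _; rewrite patchE; case: ifPn.
  by rewrite inE/= in_itv/= => r01; rewrite levelE.
rewrite notin_setE/= in_itv/= => r01.
under eq_integral => t _.
  rewrite /F indicE memNset ?mulr0; last by case.
  over.
by rewrite integral0.
Qed.

End layer_cake.

Section gauss_tuple.
Context {R : realType}.
Local Notation leb := (@lebesgue_measure R).
Local Notation tup n := (n.-tuple (measurableTypeR R)).

Definition gauss n (y : 'rV[R]_n) : R := expR (- \sum_a y 0 a ^+ 2).

Lemma measurable_gauss n : measurable_fun setT (fun t : tup n => gauss (rowt t)).
Proof.
apply: measurableT_comp => //; apply: measurable_funN; apply: measurable_sum => i.
by apply: measurable_funX; exact: measurable_coord.
Qed.

Lemma integral_gauss n :
  (\int[lebesgue_tuple n]_t (gauss (rowt t))%:E = (Num.sqrt pi ^+ n)%:E)%E.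
Proof.
elim: n => [|n IH].
  rewrite /= integral_dirac//.
    by rewrite diracT mul1e /gauss big_ord0 oppr0 expR0.
  by apply/measurable_EFinP; exact: measurable_gauss.
rewrite /= ge0_integral_pushforward//=; last 2 first.
- by apply/measurable_EFinP; exact: measurable_gauss.
- by move=> t _; rewrite lee_fin expR_ge0.
rewrite preimage_setT.
have fE x (t : tup n) : gauss (rowt (tcons (x, t))) = gauss_fun x * gauss (rowt t).
  rewrite /gauss rowt_tcons (@big_split_ord _ _ _ 1 n) big_ord1 opprD expRD.
  rewrite (@row_mxEl _ _ 1 n) mxE eqxx mulr1n; congr (_ * expR (- _)).
  by apply: eq_bigr => i _; rewrite (@row_mxEr _ _ 1 n).
rewrite fubini_tonelli1//; last 2 first.
- apply/measurable_EFinP.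
  exact: (measurableT_comp (@measurable_gauss n.+1) (@measurable_tcons _ _ n)).
- by move=> t; rewrite lee_fin expR_ge0.
under eq_integral => x _.
  rewrite /fubini_F/=; under eq_integral do rewrite fE EFinM.
  rewrite ge0_integralZl//; last 3 first.
  - by apply/measurable_EFinP; exact: measurable_gauss.
  - by move=> t _; rewrite lee_fin expR_ge0.
  - by rewrite lee_fin expR_ge0.
  rewrite IH muleC.
  over.
rewrite ge0_integralZl//.
- by rewrite integralT_gauss -EFinM -exprSr.
- by apply/measurable_EFinP; exact: measurable_gauss_fun.
- by move=> t _; rewrite lee_fin expR_ge0.
- exact: measurable_tcons.
Qed.

Definition euclid_ball n : set 'rV[R]_n := [set y | \sum_a y 0 a ^+ 2 <= 1].

Lemma euclid_ball_measurable n : rvmeasurable (@euclid_ball n).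
Proof.
rewrite /rvmeasurable; have -> : @rowt R n @^-1` @euclid_ball n =
    (fun t => \sum_a rowt t 0 a ^+ 2) @^-1` `]-oo, 1]%classic.
  by apply/seteqP; split => t /=; rewrite in_itv/=.
have mS : measurable_fun setT (fun t : tup n => \sum_a rowt t 0 a ^+ 2).
  by apply: measurable_sum => i; apply: measurable_funX; exact: measurable_coord.
by rewrite -[X in measurable X]setTI; apply: mS => //; exact: measurable_itv.
Qed.

Lemma vol_box n (I : 'I_n -> set (measurableTypeR R)) : (forall i, measurable (I i)) ->
  rvmeasurable [set y : 'rV[R]_n | forall i, I i (y 0 i)] /\
  vol [set y : 'rV[R]_n | forall i, I i (y 0 i)] = (\prod_(i < n) leb (I i))%E.
Proof.
move=> mI; have e : @rowt R n @^-1` [set y : 'rV[R]_n | forall i, I i (y 0 i)] =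
    [set t | forall i, I i (tnth t i)].
  by apply/seteqP; split => t /= h i; have := h i; rewrite mxE.
split; last by rewrite /vol e lebesgue_tuple_setX.
rewrite /rvmeasurable e.
rewrite (_ : mkset _ = \bigcap_(i in [set: 'I_n]) ((@tnth n _)^~ i @^-1` I i)).
  apply: fin_bigcap_measurable => [|i _]; first exact: finite_finset.
  by rewrite -[X in measurable X]setTI; exact: measurable_tnth.
by apply/seteqP; split => t /= h i; [move=> _|]; apply: h.
Qed.

Lemma vol_cube n (a : 'rV[R]_n) e : 0 < e ->
  rvmeasurable [set y : 'rV[R]_n | forall i, `](a 0 i - e), (a 0 i + e)[%classic (y 0 i)] /\
  vol [set y : 'rV[R]_n | forall i, `](a 0 i - e), (a 0 i + e)[%classic (y 0 i)] =
  ((e + e) ^+ n)%:E.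
Proof.
move=> e0; have [|mb ->] := @vol_box n (fun i => `](a 0 i - e), (a 0 i + e)[%classic).
  by move=> i; exact: measurable_itv.
split=> //; under eq_bigr => i _.
  rewrite lebesgue_measure_itv/= lte_fin ifT; last lra.
  rewrite -EFinD (_ : _ - _ = e + e); last ring.
  over.
by rewrite prodEFin prodr_const card_ord.
Qed.

Lemma vol_ball_fin n : exists2 v : R, 0 < v & vol (@euclid_ball n) = v%:E.
Proof.
have v1 : (0 < vol (@euclid_ball n))%E.
  pose e : R := n.+1%:R^-1; have e0 : 0 < e by rewrite invr_gt0 ltr0n.
  have [mC vC] := vol_cube (0 : 'rV[R]_n) e0.
  apply: (@lt_le_trans _ _ ((e + e) ^+ n)%:E).
    by rewrite lte_fin exprn_gt0// addr_gt0.
  rewrite -vC; apply: le_measure; rewrite ?inE//; first exact: euclid_ball_measurable.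
  move=> t /= h; rewrite /euclid_ball/=.
  apply: (@le_trans _ _ (\sum_(a < n) e ^+ 2)).
    apply: ler_sum => a _; have := h a; rewrite /= in_itv/= mxE sub0r add0r.
    rewrite -ltr_norml => /ltW he.
    by rewrite -[leLHS]real_normK ?num_real// ler_pXn2r// nnegrE// ltW.
  rewrite sumr_const card_ord -mulr_natl /e exprVn ler_pdivrMr ?exprn_gt0 ?ltr0n//.
  by rewrite mul1r -natrX ler_nat expnS expn1 (leq_trans (leqnSn n))// leq_pmull.
have v2 : (vol (@euclid_ball n) < +oo)%E.
  have [mC vC] := vol_cube (0 : 'rV[R]_n) (ltr0Sn R 1).
  apply: (@le_lt_trans _ _ ((2 + 2) ^+ n)%:E); last exact: ltry.
  rewrite -vC; apply: le_measure; rewrite ?inE//; first exact: euclid_ball_measurable.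
  move=> t /= h i; rewrite /= in_itv/= mxE sub0r add0r -ltr_norml.
  apply: (@le_lt_trans _ _ 1); last by rewrite ltr1n.
  rewrite -(@ler_pXn2r _ 2)// ?nnegrE// expr1n real_normK ?num_real//.
  apply: le_trans h; rewrite (bigD1 i)//= lerDl.
  by apply: sumr_ge0 => j _; exact: sqr_ge0.
exists (fine (vol (@euclid_ball n))); first by rewrite fine_gt0// v1 v2.
by rewrite fineK// ge0_fin_numE// ltW.
Qed.

End gauss_tuple.

(** * Measurability of the projected orthant *)

Section topology.
Context {R : realType}.

Lemma rv_nbhs_cube n (U : set 'rV[R]_n) (y : 'rV[R]_n) : nbhs y U -> exists2 e, 0 < e &
  forall z : 'rV[R]_n, (forall i, z 0 i \in `](y 0 i - e), (y 0 i + e)[) -> U z.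
Proof.
move=> /nbhs_ballP[e /= e0 yU]; exists e => // z yz; apply: yU; split => // i j.
by rewrite ord1 /ball/= ltr_distlC; have := yz j; rewrite in_itv.
Qed.

(** An open set is the union of the countably many rational cubes that it
    contains. *)
Lemma open_rvmeasurable n (U : set 'rV[R]_n) : open U -> rvmeasurable U.
Proof.
move=> oU; pose q (p : 'rV[rat]_n) : 'rV[R]_n := map_mx ratr p.
pose box (pk : 'rV[rat]_n * nat) : set 'rV[R]_n := [set y | forall i,
  `](q pk.1 0 i - pk.2.+1%:R^-1), (q pk.1 0 i + pk.2.+1%:R^-1)[%classic (y 0 i)].
pose F pk := if `[< box pk `<=` U >] then box pk else set0.
have mF pk : rvmeasurable (F pk).
  rewrite /F; case: asboolP => _; last first.
    by rewrite /rvmeasurable preimage_set0; exact: measurable0.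
  have k0 : (0 : R) < pk.2.+1%:R^-1 by rewrite invr_gt0 ltr0n.
  exact: (vol_cube (q pk.1) k0).1.
have -> : U = \bigcup_(pk in [set: 'rV[rat]_n * nat]) F pk.
  apply/seteqP; split => [y Uy|y [pk _]]; last first.
    by rewrite /F; case: asboolP => // bU /bU.
  have [e e0 yU] := rv_nbhs_cube (oU _ Uy).
  have [k ke] : exists k, (k.+1%:R^-1 : R) < e / 2.
    exists (Num.truncn (e / 2)^-1); rewrite invf_plt ?posrE ?ltr0n ?divr_gt0//.
    exact: truncnS_gt.
  pose d : R := k.+1%:R^-1; have d0 : 0 < d by rewrite invr_gt0 ltr0n.
  have {}ke : d < e / 2 by [].
  have /choice[p hp] : forall i, exists r : rat, ratr r \in `](y 0 i - d), (y 0 i + d)[.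
    by move=> i; have [|r hr] := @rat_in_itvoo R (y 0 i - d) (y 0 i + d);
      [lra|exists r].
  exists (\row_i p i, k) => //; rewrite /F asboolT.
    move=> i /=; rewrite in_itv/= /q !mxE.
    by have := hp i; rewrite in_itv/= -/d => /andP[? ?]; apply/andP; split; lra.
  move=> z /= zb; apply: yU => i; rewrite in_itv/=.
  have := zb i; rewrite /= in_itv/= /q !mxE -/d.
  by have := hp i; rewrite in_itv/= => /andP[? ?] /andP[? ?]; apply/andP; split; lra.
rewrite /rvmeasurable preimage_bigcup.
by apply: countable_bigcupT_measurable.
Qed.

Lemma closed_rvmeasurable n (A : set 'rV[R]_n) : closed A -> rvmeasurable A.
Proof.
move=> cA; have := open_rvmeasurable (closed_openC cA).
by rewrite /rvmeasurable preimage_setC => /measurableC; rewrite setCK.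
Qed.

Lemma mulmx_rv_continuous m n (V : 'M[R]_(m, n)) :
  continuous (fun x : 'rV[R]_m => x *m V).
Proof.
move=> x; have xF : Filter (nbhs x) by exact: nbhs_filter.
apply/cvg_ballP => e e0.
have H i j : \forall y \near x, ball ((x *m V) i j) e ((y *m V) i j).
  have : (y *m V) i j @[y --> x] --> (x *m V) i j.
    rewrite mxE; under eq_fun do rewrite mxE.
    apply: cvg_big; first exact: add_continuous.
    move=> k _; apply: cvgM; last exact: cvg_cst.
    exact: coord_continuous.
  by move/cvg_ballP; apply.
have := @filter_forall _ _ (fun (ij : 'I_1 * 'I_n) (y : 'rV[R]_m) =>
  ball ((x *m V) ij.1 ij.2) e ((y *m V) ij.1 ij.2)) (nbhs x) xF (fun ij => H ij.1 ij.2).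
by apply: filterS => y hy; split => // i j; exact: (hy (i, j)).
Qed.

(** It is the image of a compact set by a continuous map, hence closed. *)
Lemma orthant_image_measurable m n (V : 'M[R]_(m, n)) :
  rvmeasurable (orthant_image V).
Proof.
apply: closed_rvmeasurable; apply: compact_closed; first exact: norm_hausdorff.
pose D := [set lam : 'rV[R]_m | (forall i, 0 <= lam 0 i) /\ \sum_i lam 0 i ^+ 2 <= 1].
have -> : orthant_image V = (fun x => x *m V) @` D.
  by apply/seteqP; split => x [lam Dlam] e; exists lam.
apply: continuous_compact.
  by apply: continuous_subspaceT; exact: mulmx_rv_continuous.
apply: bounded_closed_compact.
  exists 1; split => // M M1 lam [_ lam1].
  rewrite /= [leLHS]/Num.norm/= mx_normrE; apply/bigmax_leP; split => [|[i j] _ /=].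
    by rewrite ltW// (lt_trans ltr01).
  rewrite ord1; apply: ltW; apply: le_lt_trans M1.
  rewrite -(@ler_pXn2r _ 2)// ?nnegrE// expr1n real_normK ?num_real//.
  apply: le_trans lam1; rewrite (bigD1 j)//= lerDl.
  by apply: sumr_ge0 => k _; exact: sqr_ge0.
have -> : D = (\bigcap_(i in [set: 'I_m]) (fun lam : 'rV[R]_m => lam 0 i) @^-1` [set x | 0 <= x])
    `&` (fun lam : 'rV[R]_m => \sum_i lam 0 i ^+ 2) @^-1` [set x | x <= 1].
  by apply/seteqP; split => lam [h1 h2]; split => // i; [move=> _|]; exact: h1.
apply: closedI.
  apply: closed_bigI => i _; apply: closed_comp; last exact: closed_ge.
  by move=> x _; exact: coord_continuous.
apply: closed_comp; last exact: closed_le.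
move=> x _; have xF : Filter (nbhs x) by exact: nbhs_filter.
apply: cvg_big; first exact: add_continuous.
move=> i _; rewrite expr2; under eq_fun do rewrite expr2.
by apply: cvgM; exact: coord_continuous.
Qed.

End topology.

(** * The Jacobian inequality for the transport map *)

Section density.
Context {R : realType} {m n : nat} (V : 'M[R]_(m, n)).
Hypothesis V1 : V^T *m V = 1%:M.
Let mL := orthant_image_measurable V.
Variable phi : R -> R.
Hypothesis phi_gt0 : forall t, 0 < phi t.
Hypothesis dphi : forall t : R,
  is_derive t (1 : R) phi (expR (phi t ^+ 2 - t ^+ 2 - ln 2)).
Local Notation c := (rownorm2 V).
Local Notation tup n := (n.-tuple (measurableTypeR R)).

Let phi_le : {mono phi : x y / x <= y}.
Proof. by apply: is_derive_gt0_mono dphi _ => x; rewrite expR_gt0. Qed.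

Lemma measurable_phi : measurable_fun setT (phi : measurableTypeR R -> measurableTypeR R).
Proof.
by apply: continuous_measurable_fun => t; exact: is_derive_continuous (dphi t).
Qed.

Lemma measurable_dirc i : measurable_fun setT (fun t : tup n => dirc V i (rowt t)).
Proof. by apply: measurable_funM => //; exact: measurable_linear. Qed.

Lemma det_wgram_gt0 (s : 'I_m -> R) : (forall i, 0 < s i) -> 0 < \det (wgram V s).
Proof.
move=> s0; have := det_wgram_ge V1 (fun i => ln (s i)).
rewrite (_ : wgram V _ = wgram V s).
  by apply: lt_le_trans; exact: expR_gt0.
by apply/matrixP => a b; rewrite !mxE; apply: eq_bigr => i _; rewrite /= lnK// posrE.
Qed.

(** The logarithm of [phi'] at the coordinate of [y] along row [i]. *)
Definition tau i (y : 'rV[R]_n) : R := phi (dirc V i y) ^+ 2 - dirc V i y ^+ 2 - ln 2.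

(** The Jacobian of the transport map [y |-> comb V (phi \o dirc V ^~ y)]. *)
Definition jac (y : 'rV[R]_n) : R := \det (wgram V (fun i => expR (tau i y))).

(** This is [exp (- |lam|^2)] for the coefficients [lam] of the image of [y]
    under the transport map; its superlevel sets are mapped into multiples of
    the projected orthant. *)
Definition weight (y : 'rV[R]_n) : R := expR (- \sum_i c i * phi (dirc V i y) ^+ 2).

(** [grid_weight], [cell] and [grid_jac] refer to the transport map with
    [phi] replaced by its interpolant: the weight, the part of a grid cell
    where the weight is at least [r], and the Jacobian, which is constant
    there. *)
Definition grid_weight k (kap : 'I_m -> nat) (y : 'rV[R]_n) : R :=
  expR (- \sum_i c i * chord phi k (kap i) (dirc V i y) ^+ 2).

Definition cell k r (kap : 'I_m -> nat) : set 'rV[R]_n :=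
  [set y | (forall i, gridl k (kap i) <= dirc V i y < gridl k (kap i).+1) /\
           r <= grid_weight k kap y].

Definition grid_jac k (kap : 'I_m -> nat) : R :=
  \det (wgram V (fun i => slope phi k (kap i))).

Lemma jac_gt0 y : 0 < jac y.
Proof. by apply: det_wgram_gt0 => i; exact: expR_gt0. Qed.

Lemma grid_jac_gt0 k kap : (0 < k)%N -> 0 < grid_jac k kap.
Proof. by move=> k0; apply: det_wgram_gt0 => i; exact: slope_gt0. Qed.

Lemma measurable_weighted_sum (f : 'I_m -> tup n -> R) :
  (forall i, measurable_fun setT (f i)) ->
  measurable_fun setT (fun t => expR (- \sum_i c i * f i t ^+ 2)).
Proof.
move=> mf; apply: measurableT_comp => //; apply: measurable_funN.
apply: measurable_sum => i; apply: measurable_funM => //.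
exact: measurable_funX.
Qed.

Lemma cell_measurable k r kap : rvmeasurable (cell k r kap).
Proof.
rewrite /rvmeasurable; set T1 := _ @^-1` _.
have -> : T1 = (\bigcap_(i in [set: 'I_m])
    (fun t => dirc V i (rowt t)) @^-1` `[gridl k (kap i), gridl k (kap i).+1[%classic)
    `&` (fun t => grid_weight k kap (rowt t)) @^-1` `[r, +oo[%classic.
  apply/seteqP; split=> t /=; rewrite /= in_itv/= andbT => -[h1 h2]; split=> // i.
    by move=> _; rewrite /= in_itv/=.
  by have := h1 i Logic.I; rewrite /= in_itv.
apply: measurableI.
  apply: fin_bigcap_measurable => [|i _]; first exact: finite_finset.
  by rewrite -[X in measurable X]setTI; apply: measurable_dirc => //; exact: measurable_itv.
rewrite -[X in measurable X]setTI.
suff mw : measurable_fun setT (fun t : tup n => grid_weight k kap (rowt t)).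
  by apply: mw => //; exact: measurable_itv.
apply: measurable_weighted_sum => i; apply: measurable_funD => //.
apply: measurable_funM => //; apply: measurable_funB => //.
exact: measurable_dirc.
Qed.

Lemma gridl_geN k j : (0 < k)%N -> - k%:R <= gridl k j :> R.
Proof. by move=> k0; rewrite /gridl lerDr divr_ge0. Qed.

Lemma chord_gt0 k j t : (0 < k)%N -> gridl k j <= t -> 0 < chord phi k j t.
Proof.
by move=> k0 jt; rewrite ltr_wpDr// mulr_ge0 ?subr_ge0// ltW// slope_gt0.
Qed.

Definition level_radius (r : R) : R := Num.sqrt (- ln r).

Lemma level_radius2 r : 0 < r < 1 -> 0 < level_radius r /\ level_radius r ^+ 2 = - ln r.
Proof.
move=> r01; have l0 : 0 < - ln r by rewrite oppr_gt0 ln_lt0.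
by rewrite /level_radius sqrtr_gt0 sqr_sqrtr ?ltW.
Qed.

Definition gval k (kap : {ffun 'I_m -> 'I_(2 * (k * k))}) (i : 'I_m) : nat := kap i.

(** The interpolated transport map is affine on each cell, injective by
    [comb_inj] and [chord_lt], and maps the cells of level [r] into the
    multiple of the projected orthant by the radius of that level. *)
Lemma grid_sum_le k r : (0 < k)%N -> 0 < r < 1 ->
  (\sum_(kap : {ffun 'I_m -> 'I_(2 * (k * k))})
     (grid_jac k (gval kap))%:E * vol (cell k r (gval kap)) <=
   vol [set level_radius r *: x | x in orthant_image V])%E.
Proof.
move=> k0 r01; have [h0 h2] := level_radius2 r01.
rewrite [X in (X <= _)%E](_ : _ = \sum_(kap : {ffun 'I_m -> 'I_(2 * (k * k))})
   `|grid_jac k (gval kap)|%:E * vol (cell k r (gval kap)))%E; last first.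
  by apply: eq_bigr => kap _; rewrite gtr0_norm ?grid_jac_gt0.
pose beta (kap : {ffun 'I_m -> 'I_(2 * (k * k))}) i :=
  phi (gridl k (gval kap i)) - slope phi k (gval kap i) * gridl k (gval kap i).
have chordE (kap : {ffun 'I_m -> 'I_(2 * (k * k))}) y :
    y *m wgram V (fun i => slope phi k (gval kap i)) + comb V (beta kap) =
    comb V (fun i => chord phi k (gval kap i) (dirc V i y)).
  rewrite -comb_affine; congr comb; apply/funext => i.
  by rewrite /beta /chord; ring.
apply: (vol_affine_pieces (b := fun kap => comb V (beta kap))).
- by move=> kap; rewrite unitmxE unitfE gt_eqF// grid_jac_gt0.
- by move=> kap; exact: cell_measurable.
- exact: rvmeasurable_scale.
- move=> kap y [yk yr]; rewrite chordE; apply: comb_orthant_image => //.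
    by move=> i; rewrite ltW// chord_gt0//; have /andP[] := yk i.
  rewrite h2 lerNr -ler_expR lnK ?posrE//.
  by case/andP : r01.
- move=> kap kap' y y' [yk _] [yk' _]; rewrite !chordE.
  have inc (p q : {ffun 'I_m -> 'I_(2 * (k * k))}) z w i :
      (forall i, gridl k (gval p i) <= dirc V i z < gridl k (gval p i).+1) ->
      (forall i, gridl k (gval q i) <= dirc V i w < gridl k (gval q i).+1) ->
      dirc V i z < dirc V i w ->
      chord phi k (gval p i) (dirc V i z) < chord phi k (gval q i) (dirc V i w).
    by move=> pz qw; exact: chord_lt.
  move=> /comb_inj e; apply/ffunP => i; apply: val_inj => /=.
  have dE : dirc V i y = dirc V i y'.
    by apply: e => j ?; [exact: (inc kap kap')|exact: (inc kap' kap)].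
  have kd (p : {ffun 'I_m -> 'I_(2 * (k * k))}) z :
      (forall i, gridl k (gval p i) <= dirc V i z < gridl k (gval p i).+1) ->
      gridi k (dirc V i z) = gval p i.
    move=> pz; apply/eqP; rewrite -gridiP//.
    by have /andP[+ _] := pz i; apply: le_trans; exact: gridl_geN.
  by have := kd _ _ yk'; rewrite -dE (kd _ _ yk).
Qed.

Lemma measurable_det (M : tup n -> 'M[R]_n) :
  (forall a b, measurable_fun setT (fun t => M t a b)) ->
  measurable_fun setT (fun t => \det (M t)).
Proof.
move=> mM; apply: measurable_sum => s; apply: measurable_funM => //.
by apply: measurable_prod => i _; exact: mM.
Qed.

Lemma measurable_jac : measurable_fun setT (fun t : tup n => jac (rowt t)).
Proof.
apply: measurable_det => a b; under eq_fun do rewrite mxE.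
apply: measurable_sum => i; apply: measurable_funM => //.
apply: measurableT_comp => //; apply: measurable_funB => //.
apply: measurable_funB; apply: measurable_funX.
  by apply: measurableT_comp; [exact: measurable_phi|exact: measurable_dirc].
exact: measurable_dirc.
Qed.

Lemma measurable_weight : measurable_fun setT (fun t : tup n => weight (rowt t)).
Proof.
apply: measurable_weighted_sum => i.
by apply: measurableT_comp; [exact: measurable_phi|exact: measurable_dirc].
Qed.

Lemma det_cvg (M : nat -> 'M[R]_n) (N : 'M[R]_n) :
  (forall a b, M k a b @[k --> \oo] --> N a b) ->
  \det (M k) @[k --> \oo] --> \det N.
Proof.
move=> MN; apply: cvg_big; first exact: add_continuous.
move=> s _; apply: cvgM; first exact: cvg_cst.
apply: cvg_big; first exact: mul_continuous.
by move=> i _; exact: MN.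
Qed.

(** The step function whose integral is the left-hand side of [grid_sum_le]. *)
Definition grid_fun r k (t : tup n) : R :=
  \sum_(kap : {ffun 'I_m -> 'I_(2 * (k * k))})
    grid_jac k (gval kap) * \1_(@rowt R n @^-1` cell k r (gval kap)) t.

Lemma grid_fun_ge0 r k t : (0 < k)%N -> 0 <= grid_fun r k t.
Proof. by move=> k0; apply: sumr_ge0 => i _; rewrite mulr_ge0// ltW// grid_jac_gt0. Qed.

Lemma integral_grid_fun r k : (0 < k)%N ->
  (\int[lebesgue_tuple n]_t (grid_fun r k t)%:E =
  \sum_(kap : {ffun 'I_m -> 'I_(2 * (k * k))})
     (grid_jac k (gval kap))%:E * vol (cell k r (gval kap)))%E.
Proof.
move=> k0; under eq_integral do rewrite /grid_fun -sumEFin.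
have mi (kap : {ffun 'I_m -> 'I_(2 * (k * k))}) : measurable_fun setT
    (fun t : tup n => (\1_(@rowt R n @^-1` cell k r (gval kap)) t)%:E).
  by apply/measurable_EFinP/measurable_indic; exact: cell_measurable.
rewrite ge0_integral_sum//.
- apply: eq_bigr => kap _; under eq_integral do rewrite EFinM.
  rewrite ge0_integralZl//.
    by rewrite integral_indic ?setIT//; exact: cell_measurable.
  by rewrite lee_fin ltW// grid_jac_gt0.
- by move=> kap; under eq_fun do rewrite EFinM; exact: measurable_funeM.
- by move=> kap t _; rewrite lee_fin mulr_ge0// ltW// grid_jac_gt0.
Qed.

(** For large [k] the point lies in exactly one cell of level [r], and the
    slopes on that cell converge to the derivatives of [phi]. *)
Lemma grid_fun_cvg r t : r < weight (rowt t) ->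
  grid_fun r k.+1 t @[k --> \oo] --> jac (rowt t).
Proof.
set y := rowt t => rw.
pose J k i := gridi k (dirc V i y).
have Jcvg : grid_jac k (J k) @[k --> \oo] --> jac y.
  apply: det_cvg => a b; under eq_fun do rewrite mxE.
  rewrite mxE; apply: cvg_big; first exact: add_continuous.
  move=> i _; apply: cvgM; last exact: cvg_cst.
  exact: slope_cvg (dphi _).
have wcvg : grid_weight k (J k) y @[k --> \oo] --> weight y.
  apply: continuous_cvg; first exact: continuous_expR.
  apply: cvgN; apply: cvg_big; first exact: add_continuous.
  move=> i _; apply: cvgM; first exact: cvg_cst.
  rewrite expr2; under eq_fun do rewrite expr2.
  by apply: cvgM; exact: chord_cvg (dphi _).
rewrite (@cvg_shiftS _ (fun k => grid_fun r k t)).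
apply: cvg_trans Jcvg; apply: near_eq_cvg; near=> k.
have k0 : (0 < k)%N by near: k; exists 1%N.
have yk i : - k%:R <= dirc V i y < k%:R.
  have : `|dirc V i y| < k%:R.
    apply: (@le_lt_trans _ _ (\sum_i `|dirc V i y|)).
      by rewrite (bigD1 i)//= lerDl sumr_ge0.
    by near: k; exact: nbhs_infty_gtr.
  by rewrite ltr_norml => /andP[/ltW -> ->].
have wr : r <= grid_weight k (J k) y.
  by apply: ltW; near: k; exact: (cvgr_gt _ wcvg).
pose kap : {ffun 'I_m -> 'I_(2 * (k * k))} :=
  [ffun i => Ordinal (gridi_lt k0 (yk i))].
have kapE : gval kap = J k by apply/funext => i; rewrite /gval ffunE.
rewrite /grid_fun (bigD1 kap)//= big1 ?addr0 => [|kap' ne].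
  rewrite kapE indicE mem_set ?mulr1//=; split => // i.
  by rewrite gridiP//; have /andP[] := yk i.
rewrite indicE memNset ?mulr0//= => -[cl _]; case/eqP: ne.
apply/ffunP => i; apply: val_inj; rewrite ffunE/=; apply/esym/eqP.
rewrite -gridiP//; first exact: cl.
by have /andP[] := yk i.
Unshelve. all: by end_near. Qed.

Lemma measurable_weight_gt r : measurable [set t : tup n | r < weight (rowt t)].
Proof.
have -> : [set t : tup n | r < weight (rowt t)] =
    (fun t => weight (rowt t)) @^-1` `]r, +oo[%classic.
  by apply/seteqP; split => t /=; rewrite in_itv/= andbT.
rewrite -[X in measurable X]setTI; apply: measurable_weight => //.
Qed.

Lemma limn_einf_le (u : (\bar R)^nat) x : (forall k, u k <= x)%E -> (limn_einf u <= x)%E.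
Proof.
move=> ux; rewrite limn_einf_lim; apply: lime_le; first exact: is_cvg_einfs.
by apply: nearW => k; apply: ge_ereal_inf; exists (u k) => //; exists k => /=.
Qed.

(** Fatou's lemma along the grids of step [k^-1]. Where [r < weight] the step
    functions converge to [jac]; elsewhere it is enough that they are
    nonnegative. *)
Lemma jac_level_le r : 0 < r < 1 ->
  (\int[lebesgue_tuple n]_t
     (jac (rowt t) * \1_[set t : tup n | r < weight (rowt t)] t)%:E <=
   vol [set level_radius r *: x | x in orthant_image V])%E.
Proof.
move=> r01; set I := \1__.
have mI : measurable_fun setT (I : tup n -> R).
  by apply: measurable_indic; exact: measurable_weight_gt.
have mg k : measurable_fun setT (grid_fun r k).
  apply: measurable_sum => kap.
  by apply: measurable_funM => //; apply: measurable_indic; exact: cell_measurable.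
have I0 t : 0 <= I t :> R by rewrite /I indicE.
have g0 k t : 0 <= grid_fun r k.+1 t * I t by rewrite mulr_ge0// grid_fun_ge0.
have mgI k : measurable_fun setT (fun t => (grid_fun r k.+1 t * I t)%:E).
  by apply/measurable_EFinP; exact: measurable_funM.
have -> : (\int[lebesgue_tuple n]_t (jac (rowt t) * I t)%:E =
    \int[lebesgue_tuple n]_t limn_einf (fun k => (grid_fun r k.+1 t * I t)%:E))%E.
  apply: eq_integral => t _; apply/esym.
  apply: (cvg_limn_einf_sup (l := (jac (rowt t) * I t)%:E) _).1.
  apply: cvg_EFin; first exact: nearW.
  rewrite /I indicE; have [rt|rt] := boolP (t \in _).
    apply: cvgM; last exact: cvg_cst.
    by apply: grid_fun_cvg; move: rt; rewrite inE.
  by rewrite mulr0; under eq_fun do rewrite mulr0; exact: cvg_cst.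
apply: le_trans (fatou (lebesgue_tuple n) measurableT mgI _) _.
  by move=> k t _; rewrite lee_fin.
apply: limn_einf_le => k.
apply: le_trans (grid_sum_le (ltn0Sn k) r01); rewrite -integral_grid_fun//.
apply: ge0_le_integral => //.
- by move=> t _; rewrite lee_fin.
- exact/measurable_EFinP.
- move=> t _; rewrite lee_fin ler_piMr ?grid_fun_ge0//.
  by rewrite /I indicE lern1 leq_b1.
Qed.

End density.

(** * The volume inequality *)

Section radial.
Context {R : realType} (n : nat).
Local Notation leb := (@lebesgue_measure R).
Local Notation tup n := (n.-tuple (measurableTypeR R)).

(** The layer of level [r] is a set dilated by [level_radius r], whether that
    set is the ball or the projected orthant; this constant is what the
    integral over [r] leaves in front of its volume. *)
Definition radial_moment : \bar R :=
  (\int[leb]_(r in `]0%R, 1%R[) (level_radius r ^+ n)%:E)%E.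

Lemma measurable_radius : measurable_fun (`]0%R, 1%R[%classic : set (measurableTypeR R))
  (fun r : measurableTypeR R => (level_radius r ^+ n)%:E).
Proof.
apply/measurable_EFinP/measurable_funX.
apply: (@measurableT_comp _ _ _ _ _ _ (@Num.sqrt R)).
  by apply: continuous_measurable_fun; exact: sqrt_continuous.
apply: measurable_funN; apply: measurable_funTS; exact: measurable_ln.
Qed.

Lemma gauss_level r : 0 < r < 1 ->
  [set y : 'rV[R]_n | r <= gauss y] = [set level_radius r *: x | x in @euclid_ball R n].
Proof.
move=> r01; have [h0 h2] := level_radius2 r01; have [r0 _] := andP r01.
have eqE y : (r <= gauss y) = (\sum_a y 0 a ^+ 2 <= level_radius r ^+ 2).
  by rewrite h2 lerNr -[RHS]ler_expR lnK.
apply/seteqP; split => y /=; rewrite eqE.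
  move=> yr; exists ((level_radius r)^-1 *: y); last first.
    by rewrite scalerA mulfV ?scale1r// gt_eqF.
  rewrite /euclid_ball/=; under eq_bigr do rewrite mxE exprMn exprVn.
  by rewrite -big_distrr/= ler_pdivrMl ?exprn_gt0// mulr1.
case=> x xb <-; under eq_bigr do rewrite mxE exprMn.
by rewrite -big_distrr/= ger_pMr// exprn_gt0.
Qed.

Lemma integral_gauss_ball :
  (\int[lebesgue_tuple n]_t (gauss (rowt t))%:E =
   radial_moment * vol (@euclid_ball R n))%E.
Proof.
have [v v0 ve] := @vol_ball_fin R n.
transitivity (\int[lebesgue_tuple n]_t (1 * gauss (rowt t : 'rV[R]_n))%:E)%E.
  by apply: eq_integral => t _; rewrite mul1r.
rewrite (layer_cake true)//; last 2 first.
- exact: measurable_gauss.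
- move=> t; rewrite expR_gt0 -[X in _ <= X]expR0 ler_expR oppr_le0.
  by apply: sumr_ge0 => i _; exact: sqr_ge0.
rewrite ve muleC -ge0_integralZl//; last 3 first.
- exact: measurable_radius.
- by move=> r _; rewrite lee_fin exprn_ge0// sqrtr_ge0.
- by rewrite lee_fin ltW.
apply: eq_integral => r; rewrite inE/= in_itv/= => r01.
have [h0 _] := level_radius2 r01.
under eq_integral do rewrite mul1r.
have mB := rvmeasurable_scale h0 (@euclid_ball_measurable R n).
rewrite integral_indic// ?setIT -?ve.
  by rewrite muleC -vol_scale//; [rewrite -gauss_level|exact: euclid_ball_measurable].
by have := mB; rewrite -gauss_level.
Qed.

(** The Gaussian integral and the volume of the ball are finite and positive,
    hence so is their quotient. *)
Lemma radial_moment_fin : exists2 g : R, 0 < g & radial_moment = g%:E.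
Proof.
have [v v0 ve] := @vol_ball_fin R n.
have := integral_gauss_ball; rewrite integral_gauss ve => e.
have v0' : v != 0 by rewrite gt_eqF.
exists (Num.sqrt pi ^+ n / v).
  by rewrite divr_gt0// exprn_gt0// sqrtr_gt0 pi_gt0.
by rewrite EFinM e -muleA -EFinM mulfV// mule1.
Qed.

End radial.

Section inequality.
Context {R : realType} {m n : nat} (V : 'M[R]_(m, n)).
Hypothesis V1 : V^T *m V = 1%:M.
Let mL := orthant_image_measurable V.
Variable phi : R -> R.
Hypothesis phi_gt0 : forall t, 0 < phi t.
Hypothesis dphi : forall t : R,
  is_derive t (1 : R) phi (expR (phi t ^+ 2 - t ^+ 2 - ln 2)).
Local Notation c := (rownorm2 V).
Local Notation jac := (jac V phi).
Local Notation weight := (weight V phi).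
Local Notation tau := (tau V phi).
Local Notation leb := (@lebesgue_measure R).
Local Notation tup n := (n.-tuple (measurableTypeR R)).

Lemma integral_jac_weight_le :
  (\int[lebesgue_tuple n]_t (jac (rowt t) * weight (rowt t))%:E <=
   radial_moment n * vol (orthant_image V))%E.
Proof.
have w01 (t : tup n) : 0 < weight (rowt t) <= 1.
  rewrite expR_gt0 -[X in _ <= X]expR0 ler_expR oppr_le0.
  by apply: sumr_ge0 => i _; rewrite mulr_ge0 ?sqr_ge0 ?rownorm2_ge0.
have j0 (t : tup n) : 0 <= jac (rowt t) by rewrite ltW// jac_gt0.
have mj := measurable_jac V dphi; have mw := measurable_weight V dphi.
rewrite (layer_cake false j0 mj mw w01).
have -> : (radial_moment n * vol (orthant_image V) =
   \int[leb]_(r in `]0%R, 1%R[) ((level_radius r ^+ n)%:E * vol (orthant_image V)))%E.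
  rewrite ge0_integralZr//; first exact: measurable_radius.
  by move=> r _; rewrite lee_fin exprn_ge0// sqrtr_ge0.
apply: ge0_le_integral => //.
- by move=> r _; apply: integral_ge0 => t _; rewrite lee_fin mulr_ge0.
- exact: measurable_layer.
- by apply: emeasurable_funM; [exact: measurable_radius|exact: measurable_cst].
- move=> r; rewrite /= in_itv/= => r01; have [h0 _] := level_radius2 r01.
  by rewrite -vol_scale//; exact: jac_level_le.
Qed.

(** The terms [phi^2] cancel, and the identities [sum_i c_i = n] and [sum_i
    c_i y_i^2 = |y|^2] give the factor [2^-n] and the Gaussian. *)
Lemma expR_tau_weight y :
  expR (\sum_i c i * tau i y) * weight y = (2 ^+ n)^-1 * gauss y.
Proof.
rewrite -expRD -sumrB.
rewrite (eq_bigr (fun i => - (ln 2 * c i) - c i * dirc V i y ^+ 2)); last first.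
  by move=> i _; rewrite /tau; ring.
rewrite sumrB sumrN -big_distrr/= sum_rownorm2// sum_dirc2//.
rewrite expRD; congr (_ * _).
by rewrite expRN mulr_natr -lnXn// lnK// posrE exprn_gt0.
Qed.

Lemma jac_weight_ge y : (2 ^+ n)^-1 * gauss y <= jac y * weight y.
Proof. by rewrite -expR_tau_weight ler_pM2r ?expR_gt0// det_wgram_ge. Qed.

Let mjw : measurable_fun setT (fun t : tup n => (jac (rowt t) * weight (rowt t))%:E).
Proof.
apply/measurable_EFinP; apply: measurable_funM.
  exact: measurable_jac.
exact: measurable_weight.
Qed.

Let mg : measurable_fun setT (fun t : tup n => ((2 ^+ n)^-1 * gauss (rowt t))%:E).
Proof. by apply/measurable_EFinP; apply: measurable_funM => //; exact: measurable_gauss. Qed.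

Lemma integral_scaled_gauss :
  (\int[lebesgue_tuple n]_t ((2 ^+ n)^-1 * gauss (rowt t))%:E =
  ((2 ^+ n)^-1)%:E * (radial_moment n * vol (@euclid_ball R n)))%E.
Proof.
rewrite -integral_gauss_ball; under eq_integral do rewrite EFinM.
rewrite ge0_integralZl//.
- by apply/measurable_EFinP; exact: measurable_gauss.
- by move=> t _; rewrite lee_fin expR_ge0.
Qed.

Lemma vol_ball_le : (vol (@euclid_ball R n) <= (2 ^+ n)%:E * vol (orthant_image V))%E.
Proof.
have [g g0 ge] := @radial_moment_fin R n.
have : (((2 ^+ n)^-1)%:E * (g%:E * vol (@euclid_ball R n)) <= g%:E * vol (orthant_image V))%E.
  rewrite -ge -integral_scaled_gauss; apply: le_trans integral_jac_weight_le.
  apply: ge0_le_integral => //.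
  - by move=> t _; rewrite lee_fin mulr_ge0 ?expR_ge0// invr_ge0 exprn_ge0.
  - by move=> t _; rewrite lee_fin jac_weight_ge.
rewrite muleCA lee_pmul2l// => h.
rewrite -(@lee_pmul2l _ ((2 ^+ n)^-1)%:E)//.
  by rewrite muleA -EFinM mulVf ?mul1e// gt_eqF// exprn_gt0.
Qed.

(** When the volumes agree, both integrands of the proof of [vol_ball_le]
    have the same integral, so they agree almost everywhere; a cube has
    positive volume and contains a point where they do. *)
Lemma vol_ball_eq_dense : (vol (@euclid_ball R n) = (2 ^+ n)%:E * vol (orthant_image V))%E ->
  forall (y0 : 'rV[R]_n) e, 0 < e -> exists2 y : 'rV[R]_n,
    forall i, y 0 i \in `](y0 0 i - e), (y0 0 i + e)[ &
    jac y = expR (\sum_i c i * tau i y).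
Proof.
move=> veq y0 e e0.
have [g g0 ge] := @radial_moment_fin R n.
have [v v0 ve] := @vol_ball_fin R n.
pose d (t : tup n) : R := jac (rowt t) * weight (rowt t) - (2 ^+ n)^-1 * gauss (rowt t).
have d0 t : 0 <= d t by rewrite subr_ge0 jac_weight_ge.
have md : measurable_fun setT (fun t => (d t)%:E).
  apply/measurable_EFinP; apply: measurable_funB.
    by apply/measurable_EFinP; exact: mjw.
  by apply/measurable_EFinP; exact: mg.
have Id : (\int[lebesgue_tuple n]_t (d t)%:E = 0)%E.
  have sumE : (\int[lebesgue_tuple n]_t (jac (rowt t) * weight (rowt t))%:E =
     \int[lebesgue_tuple n]_t (d t)%:E +
     \int[lebesgue_tuple n]_t ((2 ^+ n)^-1 * gauss (rowt t))%:E)%E.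
    rewrite -ge0_integralD//.
    - by apply: eq_integral => t _; rewrite -EFinD subrK.
    - by move=> t _; rewrite lee_fin.
    - by move=> t _; rewrite lee_fin mulr_ge0 ?expR_ge0// invr_ge0 exprn_ge0.
  have := integral_jac_weight_le; rewrite sumE integral_scaled_gauss ge.
  have -> : vol (orthant_image V) = ((2 ^+ n)^-1 * v)%:E.
    rewrite EFinM -ve veq muleA -EFinM mulVf ?mul1e//.
  rewrite ve -!EFinM mulrCA -[leRHS]add0e leeD2rE// => h.
  apply/le_anti; rewrite h/=; apply: integral_ge0 => t _; by rewrite lee_fin.
have : (\int[lebesgue_tuple n]_t `|(d t)%:E| = 0)%E.
  by rewrite -[RHS]Id; apply: eq_integral => t _; rewrite gee0_abs ?lee_fin.
move/(ae_eq_integral_abs (lebesgue_tuple n) measurableT md) => [N [mN N0 sN]].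
have [mC vC] := vol_cube y0 e0.
pose Q := [set y : 'rV[R]_n | forall i, `](y0 0 i - e), (y0 0 i + e)[%classic (y 0 i)].
apply: contrapT => h.
have QN : @rowt R n @^-1` Q `<=` N.
  move=> t /= tQ; apply: sN => /= /(_ Logic.I) [dt]; apply: h.
  exists (rowt t) => //.
  apply: (@mulIf _ (weight (rowt t))); first by rewrite gt_eqF// expR_gt0.
  by rewrite expR_tau_weight; apply/eqP; rewrite -subr_eq0; apply/eqP.
have : (vol Q <= lebesgue_tuple n N)%E by apply: le_measure; rewrite ?inE.
by rewrite N0 vC lee_fin leNgt exprn_gt0// addr_gt0.
Qed.

End inequality.

(** * Rigidity of the equality case *)

Section rigidity.
Context {R : realType} {m n : nat} (V : 'M[R]_(m, n)).
Hypothesis V1 : V^T *m V = 1%:M.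
Variable phi : R -> R.
Hypothesis phi_gt0 : forall t, 0 < phi t.
Hypothesis dphi : forall t : R,
  is_derive t (1 : R) phi (expR (phi t ^+ 2 - t ^+ 2 - ln 2)).
Local Notation c := (rownorm2 V).
Local Notation jac := (jac V phi).
Local Notation tau := (tau V phi).
Hypothesis jac_min_dense : forall (y0 : 'rV[R]_n) e, 0 < e ->
  exists2 y : 'rV[R]_n,
    forall i, y 0 i \in `](y0 0 i - e), (y0 0 i + e)[ &
    jac y = expR (\sum_i c i * tau i y).

Let phi_le : {mono phi : x y / x <= y}.
Proof. by apply: is_derive_gt0_mono dphi _ => x; rewrite expR_gt0. Qed.

Lemma dirc_continuous i : continuous (fun y : 'rV[R]_n => dirc V i y).
Proof.
move=> x; have xF : Filter (nbhs x) by exact: nbhs_filter.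
apply: cvgM; last exact: cvg_cst.
rewrite mxE; under eq_fun do rewrite mxE.
apply: cvg_big; first exact: add_continuous.
move=> k _; apply: cvgM; last exact: cvg_cst.
exact: coord_continuous.
Qed.

Lemma tau_continuous i : continuous (fun y : 'rV[R]_n => tau i y).
Proof.
move=> x; have xF : Filter (nbhs x) by exact: nbhs_filter.
have dc := @dirc_continuous i x.
apply: cvgB; last exact: cvg_cst.
rewrite !expr2; under eq_fun do rewrite !expr2.
have pc : phi (dirc V i y) @[y --> x] --> phi (dirc V i x).
  by apply: continuous_cvg => //; exact: is_derive_continuous (dphi _).
by apply: cvgB; apply: cvgM.
Qed.

(** By [det_wgram_eq] both sums equal the weighted mean of the [tau i] on a
    dense set, hence everywhere by continuity. *)
Lemma tau_sum_minor f g y : minor V f != 0 -> minor V g != 0 ->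
  \sum_k tau (f k) y = \sum_k tau (g k) y.
Proof.
move=> f0 g0; apply/eqP; rewrite -subr_eq0; apply/negPn/negP => yne.
pose del (z : 'rV[R]_n) := \sum_k tau (f k) z - \sum_k tau (g k) z.
have dcont : del z @[z --> y] --> del y.
  have yF : Filter (nbhs y) by exact: nbhs_filter.
  apply: cvgB; (apply: cvg_big; first exact: add_continuous);
    by move=> k _; exact: tau_continuous.
have nb : \forall z \near y, del z != 0.
  have yF : Filter (nbhs y) by exact: nbhs_filter.
  exact: (cvgr_neq0 _ dcont yne).
have [e e0 h] := rv_nbhs_cube nb.
have [z zy zE] := jac_min_dense y e0.
have /eqP := h z zy; apply; rewrite /del.
by rewrite (det_wgram_eq V1 zE f0) (det_wgram_eq V1 zE g0) subrr.
Qed.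

Definition udir i : 'rV[R]_n := (Num.sqrt (c i))^-1 *: row i V.

Lemma dircE i y : dirc V i y = (y *m (udir i)^T) 0 0.
Proof.
rewrite /udir linearZ/= -scalemxAr mxE mulrC; congr (_ * _).
by rewrite !mxE; apply: eq_bigr => k _; rewrite !mxE.
Qed.

Lemma row_udir i : row i V = Num.sqrt (c i) *: udir i.
Proof.
have [c0|c0] := eqVneq (Num.sqrt (c i)) 0; last by rewrite scalerA mulfV// scale1r.
rewrite c0 scale0r; apply: rownorm2_eq0; apply/le_anti.
by rewrite rownorm2_ge0 -sqrtr_eq0 c0 eqxx.
Qed.

Lemma udir_norm i : c i != 0 -> (udir i *m (udir i)^T) 0 0 = 1.
Proof.
move=> c0; have cp : 0 < c i by rewrite lt_neqAle eq_sym c0 rownorm2_ge0.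
rewrite /udir linearZ/= -scalemxAr -scalemxAl scalerA mxE -expr2 exprVn.
rewrite sqr_sqrtr ?ltW// [X in _ * X](_ : _ = c i) ?mulVf//.
by rewrite mxE; apply: eq_bigr => a _; rewrite !mxE expr2.
Qed.

(** The point [y = u_i - u_k] has the opposite coordinates [1 - g] and [g -
    1] along [u_i] and [u_k], where [g = <u_i, u_k>]. As [phi] is positive
    and injective, [phi (1 - g) ^+ 2 = phi (g - 1) ^+ 2] forces [g = 1]. *)
Lemma tau_inj i k : c i != 0 -> c k != 0 ->
  (forall y, tau i y = tau k y) -> udir i = udir k.
Proof.
move=> ci ck h; pose y := udir i - udir k.
pose g := (udir i *m (udir k)^T) 0 0.
have gC : (udir k *m (udir i)^T) 0 0 = g.
  by rewrite /g -[in RHS](trmxK (udir i)) -trmx_mul [RHS]mxE.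
have yi : dirc V i y = 1 - g.
  by rewrite dircE mulmxBl !mxE -gC -(udir_norm ci) !mxE.
have yk : dirc V k y = - (1 - g).
  by rewrite dircE mulmxBl !mxE opprB -[in RHS](udir_norm ck) /g !mxE.
have := h y; rewrite /tau yi yk sqrrN => /addIr/addIr/eqP.
rewrite eqf_sqr [X in _ || X]gt_eqF ?orbF; last first.
  by apply: (@lt_trans _ _ 0); rewrite ?oppr_lt0.
move=> /eqP/(inc_inj phi_le) g1; have {}g1 : g = 1 by lra.
apply/eqP; rewrite -subr_eq0 -/y; apply/eqP/rowP => a; rewrite [RHS]mxE.
have : \sum_a y 0 a ^+ 2 = 0.
  have -> : \sum_a y 0 a ^+ 2 = dirc V i y - dirc V k y.
    have bil (u v w : 'rV[R]_n) :
        (u *m v^T) 0 0 - (u *m w^T) 0 0 = (u *m (v - w)^T) 0 0.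
      by rewrite raddfB/= mulmxBr [RHS]mxE; congr (_ + _); rewrite [RHS]mxE.
    rewrite !dircE bil -/y [RHS]mxE.
    by apply: eq_bigr => b _; rewrite [y^T _ _]mxE expr2.
  by rewrite yi yk g1; lra.
move/psumr_eq0P => /(_ (fun _ _ => sqr_ge0 _))/(_ a isT)/eqP.
by rewrite sqrf_eq0 => /eqP.
Qed.

Lemma exists_minor : exists f, minor V f != 0.
Proof.
have : \sum_f minor V f ^+ 2 != 0.
  by rewrite sum_minor2// pnatr_eq0 -lt0n fact_gt0.
move=> /eqP; apply: contra_notP => /forallNP f0; rewrite big1// => f _.
by have /negP/negPn/eqP -> := f0 f; rewrite expr0n.
Qed.

(** Steinitz exchange. The minors with one row replaced by row [i] are the
    entries of [row i V] times an invertible adjugate matrix, so they do not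
    all vanish. *)
Lemma minor_exchange f i : minor V f != 0 -> c i != 0 ->
  exists k, minor V [ffun l => if l == k then i else f l] != 0.
Proof.
move=> f0 /eqP; apply: contra_notP => /forallNP h.
pose S := \matrix_(k, l) V (f k) l.
have adj0 : row i V *m \adj S = 0.
  apply/rowP => k; rewrite [RHS]mxE.
  have /negP/negPn/eqP <- := h k.
  rewrite /minor (expand_det_row _ k) mxE; apply: eq_bigr => l _.
  rewrite !mxE ffunE eqxx; congr (_ * _).
  rewrite /cofactor; congr (_ * \det _); apply/matrixP => a b; rewrite !mxE ffunE.
  by rewrite eq_sym (negbTE (neq_lift k a)).
have : row i V *m (\adj S *m S) = 0 by rewrite mulmxA adj0 mul0mx.
rewrite mul_adj_mx mul_mx_scalar => /eqP; rewrite scaler_eq0 (negbTE f0)/= => /eqP r0.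
rewrite /rownorm2 big1// => a _.
by have /rowP/(_ a) := r0; rewrite !mxE => ->; rewrite expr0n.
Qed.

(** Fix a basis among the rows of [V] and let [W] be its normalization.
    Exchange of one vector and [tau_inj] show that each nonzero row of [V]
    points in the direction of a row of [W]. Then [V^T V = 1] reads [W^T C W
    = 1] with [C] diagonal, hence [C W W^T = 1]; the rows of [W] being unit
    vectors, [C = 1] and [W] is orthogonal. *)
Lemma exists_adapted_basis : exists2 W : 'M[R]_n, W *m W^T = 1%:M &
  forall i k, 0 <= (V *m W^T) i k.
Proof.
have [f f0] := exists_minor.
pose S := \matrix_(k, l) V (f k) l.
have rowS k : row k S = row (f k) V by apply/rowP => l; rewrite !mxE.
have cf k : c (f k) != 0.
  apply: contra f0 => /eqP/rownorm2_eq0 r0.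
  rewrite /minor (expand_det_row _ k) big1// => l _.
  by have /rowP/(_ l) := r0; rewrite !mxE => ->; rewrite mul0r.
pose W := \matrix_k udir (f k).
have key i : c i != 0 -> exists k, udir i = udir (f k).
  move=> ci; have [k hk] := minor_exchange f0 ci; exists k.
  apply: tau_inj => // y; have := tau_sum_minor y f0 hk.
  rewrite (bigD1 k)//= [in RHS](bigD1 k)//= ffunE eqxx.
  rewrite [X in _ = _ + X -> _](eq_bigr (fun l => tau (f l) y)) => [/addIr//|l lk].
  by rewrite ffunE (negbTE lk).
have SW : S = diag_mx (\row_k Num.sqrt (c (f k))) *m W.
  apply/matrixP => k l; rewrite mul_diag_mx !mxE.
  by have /rowP/(_ l) := row_udir (f k); rewrite !mxE.
have uW : W \in unitmx.
  have : S \in unitmx by rewrite unitmxE unitfE.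
  by rewrite SW unitmx_mul => /andP[].
have Winj k l : udir (f k) = udir (f l) -> k = l.
  move=> e; apply/eqP; apply/negPn/negP => kl; move: uW.
  rewrite unitmxE (determinant_alternate kl) ?unitr0// => j.
  by rewrite [LHS]mxE [RHS]mxE e.
pose C k := \sum_(i | (c i != 0) && (udir i == udir (f k))) c i.
have VW : W^T *m diag_mx (\row_k C k) *m W = 1%:M.
  rewrite -V1; apply/matrixP => a b; rewrite [LHS]mxE [RHS]mxE.
  have WE k l : W k l = udir (f k) 0 l by rewrite mxE.
  transitivity (\sum_k \sum_(i | (c i != 0) && (udir i == udir (f k))) V i a * V i b).
    apply: eq_bigr => k _; rewrite mul_mx_diag mxE [W^T _ _]mxE !WE.
    rewrite [(\row__ _) _ _]mxE mulrAC big_distrr/=.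
    apply: eq_bigr => i /andP[ci /eqP e].
    have rE l : V i l = Num.sqrt (c i) * udir (f k) 0 l.
      by have /rowP/(_ l) := row_udir i; rewrite e !mxE.
    rewrite !rE -{1}(sqr_sqrtr (rownorm2_ge0 V i)); ring.
  rewrite (exchange_big_dep predT)//=
    [RHS](eq_bigr (fun i => V i a * V i b)); last by move=> i _; rewrite !mxE.
  rewrite [RHS](bigID (fun i => c i != 0))/= [X in _ = _ + X]big1 ?addr0; last first.
    move=> i; rewrite negbK => /eqP/rownorm2_eq0/rowP/(_ a).
    by rewrite !mxE => ->; rewrite mul0r.
  rewrite [LHS](bigID (fun i => c i != 0))/= [X in _ + X = _]big1 ?addr0; last first.
    by move=> i ci; rewrite big1// => k; rewrite (negbTE ci).
  apply: eq_bigr => i ci; have [k ek] := key i ci.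
  rewrite (big_pred1 k) ?ci// => l /=; rewrite ek.
  by apply/eqP/eqP => [/Winj ->|->].
have WW : W *m W^T = 1%:M.
  have h : diag_mx (\row_k C k) *m (W *m W^T) = 1%:M.
    by rewrite mulmxA; apply: mulmx1C; rewrite mulmxA.
  apply/matrixP => k l; have := congr1 (fun M : 'M[R]_n => M k l) h.
  rewrite mul_diag_mx !mxE => e.
  have Wkk j : \sum_a W j a * W^T a j = 1.
    by rewrite -(udir_norm (cf j)) !mxE; apply: eq_bigr => a _; rewrite !mxE.
  have Ck : C k = 1.
    have := congr1 (fun M : 'M[R]_n => M k k) h.
    by rewrite mul_diag_mx !mxE Wkk eqxx mulr1.
  by rewrite -e Ck mul1r.
exists W => // i k; have [c0|ci] := eqVneq (c i) 0.
  have /rowP r0 := rownorm2_eq0 c0; rewrite mxE big1// => a _.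
  by have := r0 a; rewrite !mxE => ->; rewrite mul0r.
have [l el] := key i ci.
have -> : (V *m W^T) i k = Num.sqrt (c i) * (W *m W^T) l k.
  have rE a : V i a = Num.sqrt (c i) * W l a.
    by have /rowP/(_ a) := row_udir i; rewrite el !mxE.
  rewrite [LHS]mxE [in RHS]mxE big_distrr/=; apply: eq_bigr => a _.
  by rewrite rE mulrA.
by rewrite WW mxE mulr_ge0 ?sqrtr_ge0.
Qed.

End rigidity.

(** * Sufficiency of an adapted orthonormal basis *)

Section orthant.
Context {R : realType}.

Lemma sqr_sum_mulmx n (y : 'rV[R]_n) : \sum_a y 0 a ^+ 2 = (y *m y^T) 0 0.
Proof. by rewrite mxE; apply: eq_bigr => a _; rewrite mxE expr2. Qed.

Definition pos_ball n : set 'rV[R]_n :=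
  [set y : 'rV[R]_n | (forall i, 0 <= y 0 i) /\ @euclid_ball R n y].

Definition pos_ball_int n : set 'rV[R]_n :=
  [set y : 'rV[R]_n | (forall i, 0 < y 0 i) /\ @euclid_ball R n y].

Lemma hyperplane_null n (k : 'I_n) :
  rvmeasurable [set y : 'rV[R]_n | y 0 k = 0] /\
  vol [set y : 'rV[R]_n | y 0 k = 0] = 0%E.
Proof.
pose I (j : 'I_n) : set (measurableTypeR R) := if j == k then [set 0] else setT.
have mI j : measurable (I j) by rewrite /I; case: ifP => _; [exact: measurable_set1|].
have -> : [set y : 'rV[R]_n | y 0 k = 0] = [set y | forall j, I j (y 0 j)].
  apply/seteqP; split => y /= h.
    by move=> j; rewrite /I; case: eqP => [->|].
  by have := h k; rewrite /I eqxx.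
have [m1 ->] := vol_box mI; split => //.
by rewrite (bigD1 k)//= /I eqxx lebesgue_measure_set1 mul0e.
Qed.

Lemma pos_ball_measurable n :
  rvmeasurable (@pos_ball n) /\ rvmeasurable (@pos_ball_int n).
Proof.
have mB := @euclid_ball_measurable R n.
have [m0 _] := @vol_box R n (fun=> `[0, +oo[%classic) (fun=> measurable_itv _).
have [m1 _] := @vol_box R n (fun=> `]0, +oo[%classic) (fun=> measurable_itv _).
split; rewrite /rvmeasurable.
  have -> : @rowt R n @^-1` @pos_ball n = @rowt R n @^-1`
      [set y | forall i, `[0, +oo[%classic (y 0 i)] `&` @rowt R n @^-1` @euclid_ball R n.
    by apply/seteqP; split => t [h1 h2]; split => // i; have := h1 i; rewrite /= in_itv/= andbT.
  exact: measurableI.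
have -> : @rowt R n @^-1` @pos_ball_int n = @rowt R n @^-1`
    [set y | forall i, `]0, +oo[%classic (y 0 i)] `&` @rowt R n @^-1` @euclid_ball R n.
  by apply/seteqP; split => t [h1 h2]; split => // i; have := h1 i; rewrite /= in_itv/= andbT.
exact: measurableI.
Qed.

(** The two sets differ by a subset of the coordinate hyperplanes. *)
Lemma vol_pos_ball_le n : (vol (@pos_ball n) <= vol (@pos_ball_int n))%E.
Proof.
have [mB mO] := @pos_ball_measurable n.
pose Z := \bigcup_(k in [set: 'I_n]) (@rowt R n @^-1` [set y : 'rV[R]_n | y 0 k = 0]).
have mZ : measurable Z.
  apply: fin_bigcup_measurable => [|k _]; first exact: finite_finset.
  exact: (hyperplane_null k).1.
have Z0 : lebesgue_tuple n Z = 0%E.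
  apply/eqP; rewrite -measure_le0.
  have := @content_sub_fsum _ _ _ (lebesgue_tuple n) _ [set: 'I_n]
    Z (fun k => @rowt R n @^-1` [set y : 'rV[R]_n | y 0 k = 0]).
  move=> /(_ finite_finset) h; apply: le_trans (h _ _ _) _ => //.
    by move=> k _; exact: (hyperplane_null k).1.
  rewrite fsbig1// => k _; exact: (hyperplane_null k).2.
rewrite /vol -(measureU0 (mu := lebesgue_tuple n) mO mZ Z0).
apply: le_measure; rewrite ?inE//; first exact: measurableU.
move=> t [t0 tb]; have [/forallP h|] := boolP [forall i, rowt t 0 i != 0].
  by left; split => // i; rewrite lt_neqAle eq_sym h t0.
rewrite negb_forall => /existsP[i]; rewrite negbK => /eqP ti.
by right; exists i.
Qed.

(** The [2^n] reflections of the open part in the coordinate hyperplanes are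
    disjoint and contained in the ball. *)
Lemma vol_pos_ball n :
  ((2 ^+ n)%:E * vol (@pos_ball n) <= vol (@euclid_ball R n))%E.
Proof.
have [mB mO] := @pos_ball_measurable n.
apply: (@le_trans _ _ ((2 ^+ n)%:E * vol (@pos_ball_int n))%E).
  by rewrite lee_pmul2l ?lte_fin ?exprn_gt0// vol_pos_ball_le.
pose M (s : {ffun 'I_n -> bool}) : 'M[R]_n := diag_mx (\row_i (-1) ^+ s i).
have detM s : `|\det (M s)| = 1.
  rewrite det_diag normr_prod big1// => i _.
  by rewrite mxE normrX normrN1 expr1n.
have ME s (y : 'rV[R]_n) i : (y *m M s) 0 i = y 0 i * (-1) ^+ s i.
  by rewrite mul_mx_diag !mxE.
have Mpos s y i : @pos_ball_int n y -> (0 < (y *m M s) 0 i) = ~~ s i.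
  move=> [y0 _]; rewrite ME; case: (s i).
    by rewrite mulrN1 oppr_gt0 ltNge ltW.
  by rewrite mulr1 y0.
have := @vol_affine_pieces R n {ffun 'I_n -> bool} (fun=> @pos_ball_int n) M
  (fun=> 0) (@euclid_ball R n).
have [v v0 ve] := @vol_ball_fin R n.
have [x ->] : exists x, vol (@pos_ball_int n) = x%:E.
  exists (fine (vol (@pos_ball_int n))); rewrite fineK// ge0_fin_numE//.
  apply: (@le_lt_trans _ _ v%:E); last exact: ltry.
  rewrite -ve; apply: le_measure; rewrite ?inE//; first exact: euclid_ball_measurable.
  by move=> t [].
under eq_bigr do rewrite detM mul1e.
rewrite sumEFin sumr_const card_ffun card_bool card_ord  -[x *+ _]mulr_natl natrX EFinM.
apply.
- by move=> s; rewrite unitmxE unitfE -normr_eq0 detM oner_neq0.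
- by move=> s; exact: mO.
- exact: euclid_ball_measurable.
- move=> s y [_ yb]; rewrite addr0 /euclid_ball/=.
  rewrite (eq_bigr (fun a => y 0 a ^+ 2)) => [//|a _].
  by rewrite ME exprMn sqrr_sign mulr1.
- move=> s s' y y' yP yP'; rewrite !addr0 => e; apply/ffunP => i.
  by apply: negb_inj; rewrite -(Mpos s y)// -(Mpos s' y')// e.
Qed.

End orthant.

Section projected_orthant.
Context {R : realType} {m n : nat} (V : 'M[R]_(m, n)).
Hypothesis V1 : V^T *m V = 1%:M.

(** Bessel's inequality. *)
Lemma sum_sqr_mulmx_le (x : 'rV[R]_m) :
  \sum_a (x *m V) 0 a ^+ 2 <= \sum_i x 0 i ^+ 2.
Proof.
have : 0 <= \sum_i (x - x *m V *m V^T) 0 i ^+ 2 by apply: sumr_ge0 => i _; exact: sqr_ge0.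
rewrite !sqr_sum_mulmx; set p := x *m V.
have -> : (x - p *m V^T) *m (x - p *m V^T)^T = x *m x^T - p *m p^T.
  rewrite raddfB/= mulmxBl !mulmxBr !trmx_mul trmxK !mulmxA -/p.
  rewrite -[p *m V^T *m V]mulmxA V1 mulmx1.
  rewrite -[p *m V^T *m x^T]mulmxA -trmx_mul -/p subrr subr0.
  by [].
have subE (A B : 'M[R]_1) : (A - B) 0 0 = A 0 0 - B 0 0 by rewrite !mxE.
by rewrite subE subr_ge0.
Qed.

Lemma linear_image_ball :
  [set y | exists2 x : 'rV[R]_m, \sum_i x 0 i ^+ 2 <= 1 & y = x *m V] =
  @euclid_ball R n.
Proof.
apply/seteqP; split => [y [x x1 ->]|y y1].
  exact: le_trans (sum_sqr_mulmx_le x) x1.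
exists (y *m V^T); last by rewrite -mulmxA V1 mulmx1.
move: y1; rewrite /euclid_ball/= !sqr_sum_mulmx trmx_mul trmxK mulmxA.
by rewrite -[y *m V^T *m V]mulmxA V1 mulmx1.
Qed.

(** In the basis formed by the rows of [W] the projected orthant is the
    nonnegative part of the ball: [V W^T] has orthonormal columns and no
    negative entry, so the coefficients [y W^T (V W^T)^T] of a point [y] are
    nonnegative and have the norm of [y]. *)
Lemma adapted_basis_vol (W : 'M[R]_n) : W *m W^T = 1%:M ->
  (forall i k, 0 <= (V *m W^T) i k) ->
  ((2 ^+ n)%:E * vol (orthant_image V) <= vol (@euclid_ball R n))%E.
Proof.
move=> WW P0; have WW' := mulmx1C WW.
apply: le_trans (@vol_pos_ball R n).
have -> : orthant_image V = (fun x => x *m W^T) @^-1` @pos_ball R n.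
  apply/seteqP; split => [_ [lam [lam0 lam1] ->]|y [y0 y1]].
    split => [k|].
      rewrite -mulmxA mxE; apply: sumr_ge0 => i _; exact: mulr_ge0.
    rewrite /euclid_ball/= sqr_sum_mulmx trmx_mul trmxK mulmxA -[X in X *m _]mulmxA WW' mulmx1.
    by rewrite -sqr_sum_mulmx; apply: le_trans (sum_sqr_mulmx_le lam) lam1.
  exists (y *m W^T *m (V *m W^T)^T).
    split => [i|].
      by rewrite mxE; apply: sumr_ge0 => k _; rewrite mulr_ge0// mxE.
    move: y1; rewrite /euclid_ball/= !sqr_sum_mulmx.
    set Q := V *m W^T; have QQ : Q^T *m Q = 1%:M.
      by rewrite trmx_mul trmxK mulmxA -[W *m V^T *m V]mulmxA V1 mulmx1.
    rewrite [(y *m W^T *m Q^T)^T]trmx_mul trmxK mulmxA.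
    rewrite -[y *m W^T *m Q^T *m Q]mulmxA QQ mulmx1.
    by rewrite trmx_mul trmxK mulmxA -[y *m W^T *m W]mulmxA WW' mulmx1.
  by rewrite trmx_mul trmxK -!mulmxA V1 mulmx1 WW' mulmx1.
rewrite lee_pmul2l ?lte_fin ?exprn_gt0//.
have dW : `|\det W^T| = 1.
  have := congr1 determinant WW; rewrite det_mulmx det_tr det1 -expr2 => /eqP.
  by rewrite sqrf_eq1 => /orP[] /eqP ->; rewrite ?normrN normr1.
have uW : W^T \in unitmx by rewrite unitmxE unitfE -normr_eq0 dW oner_neq0.
rewrite -(vol_linear uW (@pos_ball_measurable R n).1) dW mul1e.
by [].
Qed.

End projected_orthant.

Section equality_case.
Context {R : realType} {m n : nat} (V : 'M[R]_(m, n)).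
Hypothesis V1 : V^T *m V = 1%:M.

Lemma vol_ball_le_orthant_image :
  (vol (@euclid_ball R n) <= (2 ^+ n)%:E * vol (orthant_image V))%E.
Proof.
have [phi phi0 dphi] := @half_gauss_transport R.
exact: (vol_ball_le V1 phi0 dphi).
Qed.

Lemma vol_ball_eq_orthant_image :
  vol (@euclid_ball R n) = ((2 ^+ n)%:E * vol (orthant_image V))%E <->
  exists2 W : 'M[R]_n, W *m W^T = 1%:M & forall i k, 0 <= (V *m W^T) i k.
Proof.
split=> [veq|[W WW P0]].
  have [phi phi0 dphi] := @half_gauss_transport R.
  apply: (exists_adapted_basis V1 phi0 dphi).
  exact: (vol_ball_eq_dense V1 phi0 dphi veq).
apply/le_anti; rewrite vol_ball_le_orthant_image/=.
exact: (adapted_basis_vol V1 WW P0).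
Qed.

End equality_case.

(** * Coordinates on the subspace *)

Section onb_matrix.
Context {R : realType} {m : nat} (E : {vspace 'rV[R]_m}).

Lemma enorm_le1 (u : 'rV[R]_m) : (enorm u <= 1) = (\sum_i u 0 i ^+ 2 <= 1).
Proof.
rewrite /enorm -[X in _ <= X]sqrtr1 ler_sqrt//.
Qed.

Lemma enorm1 (u : 'rV[R]_m) : (enorm u = 1) <-> dotv u u = 1.
Proof.
rewrite /enorm; split => [h|->]; last exact: sqrtr1.
by rewrite -[LHS](sqr_sqrtr (dotv_ge0 u)) h expr1n.
Qed.

Definition onb_mx : 'M[R]_(m, \dim E) := \matrix_(i, j) tnth (onb E) j 0 i.
Local Notation V := onb_mx.

Lemma onb_mx1 : V^T *m V = 1%:M.
Proof.
have [_ ob] := onbP E; apply/matrixP => j k; rewrite !mxE -ob.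
by apply: eq_bigr => i _; rewrite !mxE.
Qed.

Lemma onb_combE (t : 'I_(\dim E) -> R) :
  \sum_i t i *: tnth (onb E) i = (\row_i t i) *m V^T.
Proof.
apply/rowP => a; rewrite summxE mxE; apply: eq_bigr => i _.
by rewrite !mxE.
Qed.

Lemma mulmx_onb_mem (z : 'rV[R]_(\dim E)) : z *m V^T \in E.
Proof.
have -> : z = \row_i z 0 i by apply/rowP => i; rewrite mxE.
rewrite -onb_combE; apply: memv_suml => i _; apply: memvZ.
by apply: (basis_mem (onbP E).1); exact: mem_tnth.
Qed.

Lemma mem_onb (x : 'rV[R]_m) : x \in E -> x *m V *m V^T = x.
Proof.
move=> xE; have := coord_basis (onbP E).1 xE.
rewrite (eq_bigr (fun i => coord (onb E) i x *: tnth (onb E) i)); last first.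
  by move=> i _; rewrite -tnth_nth.
rewrite onb_combE; set z := \row_i _ => ->.
by rewrite -[z *m V^T *m V]mulmxA onb_mx1 mulmx1.
Qed.

Lemma oproj_onb (x : 'rV[R]_m) : oproj E x = x *m V *m V^T.
Proof.
rewrite -(mem_onb (oproj_mem E x)); congr (_ *m _).
apply/esym/eqP; rewrite -subr_eq0 -mulmxBl; apply/eqP/rowP => j; rewrite [RHS]mxE.
have bE : tnth (onb E) j \in E by apply: (basis_mem (onbP E).1); exact: mem_tnth.
rewrite -[RHS](oproj_orth x bE) mxE; apply: eq_bigr => i _.
by congr (_ * _); rewrite mxE.
Qed.

(** Right multiplication by [onb_mx] gives the coordinates of a projection in
    the orthonormal basis that defines [lebesgue_on]. *)
Lemma lebesgue_on_oproj (A : set 'rV[R]_m) :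
  lebesgue_on E (oproj E @` A) =
  vol [set y : 'rV[R]_(\dim E) | exists2 x, A x & y = x *m V].
Proof.
rewrite /lebesgue_on /vol; congr (lebesgue_tuple _ _).
apply/seteqP; split => t /=; rewrite onb_combE -/(rowt t).
  case=> x Ax e; exists x => //.
  have := congr1 (fun z => z *m V) e; rewrite oproj_onb -!mulmxA onb_mx1 !mulmx1.
  by move=> ->.
by case=> x Ax ->; exists x; rewrite // oproj_onb.
Qed.

Lemma oproj_delta_eq0 i : (oproj E (delta_mx 0 i) == 0) = (row i V == 0).
Proof.
rewrite oproj_onb -rowE; apply/eqP/eqP => [e|->]; last by rewrite mul0mx.
by rewrite -[LHS]mulmx1 -onb_mx1 mulmxA e mul0mx.
Qed.

End onb_matrix.

Theorem theorem1 (R : realType) (m n : nat) (n_ge1 : (1 <= n)%N)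
    (n_le_m : (n <= m)%N) (E : {vspace 'rV[R]_m}) (dimE : \dim E = n) :
  let vol_ball := lebesgue_on E (oproj E @` unit_ball) in
  let vol_orthant := lebesgue_on E (oproj E @` (unit_ball `&` nonneg_orthant)) in
  (vol_ball <= (2 ^+ n)%:E * vol_orthant)%E /\
  (vol_ball = ((2 ^+ n)%:E * vol_orthant)%E <->
   exists U : 'I_n.+1 -> {set 'I_m},
     [/\ (forall j k, j != k -> (U j :&: U k = finset.set0)%SET),
         (\bigcup_j U j)%SET = finset.setT,
         (forall j : 'I_n, U (lift ord0 j) != finset.set0),
         U ord0 = [set i : 'I_m | oproj E (delta_mx 0 i) == 0]%SET
       & exists w : n.-tuple 'rV[R]_m,
           (forall j, enorm (tnth w j) = 1 /\
                      pos_cone (U (lift ord0 j)) (tnth w j)) /\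
           E = <<w>>%VS]).
Proof.
move=> vol_ball vol_orthant; subst n.
have V1 := onb_mx1 E; set V := onb_mx E in V1 *.
have -> : vol_ball = vol (@euclid_ball R (\dim E)).
  rewrite /vol_ball lebesgue_on_oproj -(linear_image_ball V1); congr vol.
  by apply/seteqP; split => y [x x1 e]; exists x => //; move: x1;
    rewrite /unit_ball/= enorm_le1.
have -> : vol_orthant = vol (orthant_image V).
  rewrite /vol_orthant lebesgue_on_oproj; congr vol.
  apply/seteqP; split => y [x x1 e]; exists x => //; move: x1.
    by case; rewrite /unit_ball/= enorm_le1.
  by case; rewrite /unit_ball/= -enorm_le1.
split; first exact: vol_ball_le_orthant_image.
rewrite vol_ball_eq_orthant_image//; split.
  case=> W WW P0; have WW' := mulmx1C WW.
  (* The columns of [P] are the coordinates of the vectors [w_k]; the index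
     [0] of [U] is kept for the zero rows of [P], that is, for the [e_i]
     whose projection vanishes. *)
  pose P := V *m W^T; have PP : P^T *m P = 1%:M.
    by rewrite trmx_mul trmxK mulmxA -[W *m V^T *m V]mulmxA V1 mulmx1.
  have {}P0 i k : 0 <= P i k by exact: P0.
  have rowP0 i : (row i V == 0) = [forall k, P i k == 0].
    apply/eqP/forallP => [r0 k|r0].
      rewrite mxE big1// => a _; have /rowP/(_ a) := r0.
      by rewrite !mxE => ->; rewrite mul0r.
    rewrite -[LHS]mulmx1 -WW' mulmxA -row_mul -/P.
    have -> : row i P = 0 by apply/rowP => k; rewrite [LHS]mxE [RHS]mxE; exact/eqP.
    by rewrite mul0mx.
  (* The columns are orthogonal and nonnegative, so each product of entries
     vanishes. *)
  have Pdisj i k l : k != l -> P i k * P i l = 0.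
    move=> kl; have := congr1 (fun M : 'M[R]_(\dim E) => M k l) PP.
    rewrite [RHS]mxE (negbTE kl) mxE => /psumr_eq0P h.
    have F0 j : true -> 0 <= P^T k j * P j l by move=> _; rewrite [P^T _ _]mxE mulr_ge0.
    by have := h F0 i isT; rewrite [P^T _ _]mxE.
  pose U (j : 'I_(\dim E).+1) : {set 'I_m} :=
    if unlift ord0 j is Some k then [set i | P i k != 0]%SET
    else [set i | [forall k, P i k == 0]]%SET.
  have US k : U (lift ord0 k) = [set i | P i k != 0]%SET by rewrite /U liftK.
  have U0 : U ord0 = [set i | [forall k, P i k == 0]]%SET by rewrite /U unlift_none.
  exists U; split.
  - move=> j k jk; apply/setP => i; rewrite !inE.
    case: (unliftP ord0 j) jk => [j' ->|->]; case: (unliftP ord0 k) => [k' ->|->].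
    + rewrite (inj_eq lift_inj) !US !inE => /(Pdisj i)/eqP.
      by rewrite mulf_eq0 => /orP[] ->; rewrite ?andbF.
    + by rewrite US U0 !inE => _; apply/andP => -[pj /forallP/(_ j')]; rewrite (negbTE pj).
    + by rewrite US U0 !inE => _; apply/andP => -[/forallP/(_ k') ->].
    + by rewrite eqxx.
  - apply/setP => i; rewrite inE; apply/bigcupP.
    have [h|] := boolP [forall k, P i k == 0]; first by exists ord0; rewrite // U0 inE.
    rewrite negb_forall => /existsP[k pk].
    by exists (lift ord0 k); rewrite // US inE.
  - move=> k; apply/set0Pn; rewrite US.
    have : (P^T *m P) k k != 0 by rewrite PP mxE eqxx oner_neq0.
    apply: contraNP => /forallNP h; rewrite mxE big1// => i _.
    by have /negP := h i; rewrite inE negbK => /eqP ->; rewrite mulr0.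
  - by rewrite U0; apply/setP => i; rewrite !inE oproj_delta_eq0 rowP0.
  pose w := [tuple row k (W *m V^T) | k < \dim E].
  have wE k i : tnth w k 0 i = P i k.
    by rewrite tnth_mktuple -[W]trmxK -trmx_mul !mxE.
  exists w; split=> [k|].
    split.
      apply/enorm1; have := congr1 (fun M : 'M[R]_(\dim E) => M k k) PP.
      rewrite [RHS]mxE eqxx mxE => e; rewrite -[RHS]e; apply: eq_bigr => i _.
      by rewrite !wE [P^T _ _]mxE.
    exists (fun i => P i k) => [i|].
      by rewrite US inE lt_neqAle eq_sym => ->; rewrite P0.
    apply/rowP => i; rewrite wE summxE big_mkcond/= (bigD1 i)//= big1 ?addr0 => [|j ji].
      by rewrite US inE !mxE !eqxx mulr1; case: eqP.
    by case: ifP => // _; rewrite !mxE eqxx eq_sym (negbTE ji) mulr0.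
  apply/eqP; rewrite eqEsubv; apply/andP; split; last first.
    apply/span_subvP => x /tnthP[k ->]; rewrite tnth_mktuple row_mul.
    exact: mulmx_onb_mem.
  apply/subvP => x xE; rewrite -(mem_onb xE) -/V.
  have -> : x *m V *m V^T = x *m V *m W^T *m (W *m V^T).
    by rewrite !mulmxA -[x *m V *m W^T *m W]mulmxA WW' mulmx1.
  rewrite mulmx_sum_row; apply: memv_suml => k _; apply: memvZ.
  by apply: memv_span; apply/tnthP; exists k; rewrite tnth_mktuple.
case=> U [Udisj _ _ _ [w [wP Ew]]].
pose X := \matrix_k tnth w k.
have XV : X *m V *m V^T = X.
  apply/row_matrixP => k; rewrite !row_mul rowK; apply: mem_onb.
  by have := memv_span (mem_tnth k w); rewrite -Ew.
have Xpos k i : if i \in U (lift ord0 k) then 0 < X k i else X k i == 0.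
  have [_ [l l0 we]] := wP k.
  have -> : X k i = if i \in U (lift ord0 k) then l i else 0.
    rewrite mxE we summxE big_mkcond/= (bigD1 i)//= big1 ?addr0 => [|j ji].
      by case: ifP => // _; rewrite !mxE !eqxx mulr1.
    by case: ifP => // _; rewrite !mxE eqxx eq_sym (negbTE ji) mulr0.
  by have [/l0|_] := boolP (i \in U (lift ord0 k)).
(* The rows of [X] lie in [E]; [X *m V] gives their coordinates in the
   orthonormal basis. *)
exists (X *m V).
  rewrite trmx_mul mulmxA XV; apply/matrixP => k l; rewrite !mxE.
  have [<-|kl] := eqVneq k l.
    have [/enorm1 <- _] := wP k.
    by apply: eq_bigr => i _; rewrite !mxE.
  apply: big1 => i _; rewrite [X^T _ _]mxE.
  have := Xpos k i; case: ifP => [ik _|_ /eqP ->]; last by rewrite mul0r.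
  have := Xpos l i; case: ifP => [il _|_ /eqP ->]; last by rewrite mulr0.
  have := Udisj (lift ord0 k) (lift ord0 l).
  rewrite (inj_eq lift_inj) => /(_ kl)/setP/(_ i).
  by rewrite !inE ik il.
move=> i k; rewrite trmx_mul mulmxA.
have -> : V *m V^T *m X^T = X^T by rewrite -[in RHS]XV !trmx_mul trmxK mulmxA.
rewrite mxE; have := Xpos k i; by case: ifP => _ => [/ltW|/eqP ->].
Qed.
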